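(* Let $a\ge 1$ be an integer. For time $t\in\mathbb{R}^{+}$, let $W(t)$ and $B(t)$ be respectively the number of white and blue balls in a (tenable) constant-differentials Pólya process on white and blue balls with the replacement matrix $$\begin{pmatrix} -a & -a\\ a & a\end{pmatrix},$$ and of differential index $\Delta = B(0)-W(0)\ge 1$. As $t\to\infty$, we have $$\frac{W(t)}{t}\ \overset{D}{\longrightarrow}\ \mathrm{Gamma}\Bigl(\frac{\Delta}{a},\,a^2\Bigr).$$
   Context: Constant-differentials Pólya process: an urn starts with fixed (deterministic) numbers $W(0)\ge 0$ of white and $B(0)\ge 0$ of blue balls. Each ball in the urn carries a clock that rings after an exponential time with mean $1$, all clocks being independent of each other and of the past; newly added balls get their own independent clocks. When the clock of a ball rings (an epoch), that ball is drawn, put back, and the replacement rule is executed instantaneously. Rows of the replacement matrix are indexed by the colour of the drawn ball (white, then blue) and columns by the colour added (white, then blue), a negative entry meaning removal. With the matrix $\begin{pmatrix} -a & -a\\ a & a\end{pmatrix}$: if a white ball is drawn, $a$ white and $a$ blue balls are removed; if a blue ball is drawn, $a$ white and $a$ blue balls are added. Thus $B(t)-W(t)=\Delta$ for all $t$; the constant $\Delta$ is called the differential index. The process is assumed tenable: on every possible stochastic path the rule can be executed forever, i.e. the urn is never empty when a draw is needed, and there are always enough balls of each colour to carry out the required removals. $\mathrm{Gamma}(\alpha,\beta)$ denotes the gamma distribution with shape parameter $\alpha$ and scale parameter $\beta$ (moment generating function $(1-\beta x)^{-\alpha}$ for $x<1/\beta$). $\overset{D}{\longrightarrow}$ denotes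 convergence in distribution. *)

(* Defs.v *)
From HB Require Import structures.
From mathcomp Require Import all_boot all_order all_algebra.
From mathcomp Require Import all_classical all_reals all_analysis.

Set Implicit Arguments.
Unset Strict Implicit.
Unset Printing Implicit Defensive.

Import Order.TTheory GRing.Theory Num.Theory.
Import numFieldNormedType.Exports.

Local Open Scope classical_set_scope.
Local Open Scope ring_scope.

(* Colours are indexed by 'I_2: 0 is white, 1 is blue.  [M c c'] is the number
   of balls of colour c' added (removed, if negative) when c is drawn. *)

Section Tenability.
Variables (M : 'M[int]_2) (w0 b0 : nat).

(* Compositions (white, blue) occurring on some path of draws. *)
Inductive reachable : nat -> nat -> Prop :=
| reachable_init : reachable w0 b0
| reachable_white w b w' b' of reachable w b & (0 < w)%N &
    w'%:Z = w%:Z + M 0 0 & b'%:Z = b%:Z + M 0 1 : reachable w' b'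
| reachable_blue w b w' b' of reachable w b & (0 < b)%N &
    w'%:Z = w%:Z + M 1 0 & b'%:Z = b%:Z + M 1 1 : reachable w' b'.

Definition tenable : Prop :=
  forall w b, reachable w b ->
    [/\ (0 < w + b)%N,
        (0 < w)%N -> 0 <= w%:Z + M 0 0 /\ 0 <= b%:Z + M 0 1 &
        (0 < b)%N -> 0 <= w%:Z + M 1 0 /\ 0 <= b%:Z + M 1 1].

End Tenability.

(* A ball is represented by the absolute time of the next ring of its clock; an
   urn is the list of its white balls together with the list of its blue balls.
   A clock keeps running until it rings or its ball is removed.
   [clock (n, k)] is the duration of the k-th clock started at the n-th epoch
   (epoch 0 being time 0). *)
Section Urn.
Variables (R : realType) (M : 'M[int]_2) (w0 b0 : nat).
Variable clock : nat * nat -> R.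

Definition urn : Type := seq R * seq R.

Definition next_ring (u : urn) : R :=
  let l := u.1 ++ u.2 in foldr Num.min (head 0 l) l.

(* Balls are kept in order of insertion and the oldest ones are removed first;
   balls of one colour are interchangeable, so that any rule that does not look
   at the clocks gives the same law for the numbers of balls. *)
Definition replacement (m : int) (new : nat -> R) (s : seq R) : seq R :=
  match m with
  | Posz k => s ++ mkseq new k
  | Negz k => drop k.+1 s
  end.

Definition initial_urn : urn :=
  (mkseq (fun k => clock (0, k)%N) w0,
   mkseq (fun k => clock (0, w0 + k)%N) b0).

(* Transition at epoch n: the ball whose clock rings first is drawn and put back
   with a new clock, then the replacement rule is executed.  Ties, which are
   null events, go to the first ball of the list. *)
Definition draw (n : nat) (u : urn) : urn :=
  let now := next_ring u in
  let new k := now + clock (n, k) in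
  let l := u.1 ++ u.2 in
  let i := index now l in
  let c : 'I_2 := if (i < size u.1)%N then 0 else 1 in
  let l' := set_nth 0 l i (new 0%N) in
  (replacement (M c 0) (fun k => new k.+1) (take (size u.1) l'),
   replacement (M c 1) (fun k => new (`|M c 0%R| + k).+1)
     (drop (size u.1) l')).

(* The urn just after the n-th epoch. *)
Fixpoint urn_after (n : nat) : urn :=
  if n is n'.+1 then draw n (urn_after n') else initial_urn.

Definition epoch (n : nat) : R :=
  if n is n'.+1 then next_ring (urn_after n') else 0.

End Urn.

Section Process.
Context d (T : measurableType d) (R : realType) (P : probability T R).

Definition mutually_independent (I : eqType) (X : I -> {RV P >-> R}) : Prop :=
  forall (s : seq I) (A : I -> set R), uniq s ->
    (forall i, measurable (A i)) ->
    P (\big[setI/setT]_(i <- s) (X i @^-1` A i)) =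
    (\prod_(i <- s) P (X i @^-1` A i))%E.

Definition exponential_clocks (X : nat * nat -> {RV P >-> R}) : Prop :=
  mutually_independent X /\
  forall i (A : set R), measurable A ->
    distribution P (X i) A = exponential_prob 1 A.

(* [W t] and [B t] are the numbers of white and blue balls at time t >= 0 in the
   urn driven by some family of independent exponential clocks of mean 1. *)
Definition polya_process (M : 'M[int]_2) (w0 b0 : nat)
    (W B : R -> {RV P >-> R}) : Prop :=
  exists2 X : nat * nat -> {RV P >-> R}, exponential_clocks X &
  {ae P, forall x : T, let clock i := X i x in
    forall (n : nat) (t : R),
      epoch M w0 b0 clock n <= t < epoch M w0 b0 clock n.+1 ->
      W t x = (size (urn_after M w0 b0 clock n).1)%:R /\
      B t x = (size (urn_after M w0 b0 clock n).2)%:R}.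

(* Convergence of the distribution functions at every continuity point of the
   limiting one. *)
Definition cvg_in_distribution (X : R -> {RV P >-> R})
    (mu : set R -> \bar R) : Prop :=
  forall x : R, {for x, continuous (fun y : R => mu `]-oo, y]%classic)} ->
    cdf (X t) x @[t --> +oo] --> mu `]-oo, x]%classic.

End Process.

Section Gamma.
Variable R : realType.

Definition Gamma_fun (alpha : R) : R :=
  \int[lebesgue_measure]_(x in `]0, +oo[) (x `^ (alpha - 1) * expR (- x)).

(* Shape alpha, scale beta. *)
Definition gamma_pdf (alpha beta x : R) : R :=
  if 0 < x then
    x `^ (alpha - 1) * expR (- (x / beta)) / (Gamma_fun alpha * beta `^ alpha)
  else 0.

Definition gamma_law (alpha beta : R) (A : set R) : \bar R :=
  (\int[lebesgue_measure]_(x in A) (gamma_pdf alpha beta x)%:E)%E.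

End Gamma.

Definition constant_differentials_mx (a : nat) : 'M[int]_2 :=
  \matrix_(i < 2, j < 2) (if i == 0 then - a%:Z else a%:Z).

Definition differential_index (w0 b0 : nat) : int := b0%:Z - w0%:Z.

(* Main.v *)
Require Import Defs.
From HB Require Import structures.
From mathcomp Require Import all_boot all_order all_algebra.
From mathcomp Require Import all_classical all_reals all_analysis.
From mathcomp Require Import measurable_realfun ring lra zify.

(** Write D for the differential index, so that an urn with w white balls has
    w + D blue ones. As all clocks are exponential of mean 1, the number of
    white balls is a Markov chain that jumps from w to w - a at rate w and to
    w + a at rate w + D; tenability forces a to divide w. This is a critical
    linear birth and death chain with immigration, and its Laplace transform is
    explicit: with q = 1 - exp (- a theta) and u = 1 + a q t,

      E exp (- theta W(t)) = ((u - q) / u) ^ (W(0) / a) * u ^ (- D / a).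

    For theta = k / t, as t grows, q t tends to a k and q to 0, so the transform
    of W(t) / t at k tends to (1 + a^2 k) ^ (- D / a), which is that of
    Gamma(D / a, a^2).

    The urn is given pathwise, by families of clocks, so the Markov property has
    to be established. The clocks live on a product space whose law Q is
    invariant when one clock is replaced by a fresh one ([resample]); applied
    one clock at a time, the lack of memory of the exponential law says that,
    given that all clocks of a list exceed x, they can be replaced by clocks
    that start afresh at time x ([memoryless]). Balls carry labels, the indices
    of their clocks, and at each epoch the clocks of the surviving balls are
    restarted in this way: the labels remain distinct, and the urn is again an
    urn with fresh clocks. Hence, if H n s w is a payoff depending on the number
    n of past epochs, the time s and the number w of white balls, and if H is
    harmonic for one step of the chain, then the expected payoff collected after
    m epochs, or at time t if it comes first, is H at the starting point
    ([stopped_integral]). A payoff is harmonic as soon as it solves the backward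
    Kolmogorov equation ([payoff_until_harmonic]).

    Two solutions are used. [epoch_payoff] is the expected number of epochs; it
    bounds the probability of seeing m epochs before t by a constant over m, so
    the process does not explode. [laplace_payoff] gives the Laplace transform
    ([laplace_process]).

    Finally, integer values of the transform suffice: they are the moments of
    exp (- W(t) / t), which takes its values in [0, 1], and by Bernstein
    approximation of piecewise linear functions they control the distribution
    functions at the continuity points of the limit ([cdf_cvg_of_laplace]). *)

Set Implicit Arguments.
Unset Strict Implicit.
Unset Printing Implicit Defensive.

Import Order.TTheory GRing.Theory Num.Theory.
Import numFieldNormedType.Exports.

Local Open Scope classical_set_scope.
Local Open Scope ring_scope.

(** * The space of clocks *)
Section clock_space.
Context {I : choiceType} {R : realType}.

Definition cylinder (s : seq I) (A : I -> set R) : set (I -> R) :=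
  [set c | forall i, i \in s -> A i (c i)].

(** Cylinders over finitely many coordinates are stable under intersection, so a
    probability on the product is determined by them; taking them all as
    generators, instead of the one-coordinate ones, makes this immediate. *)
Definition cylinders : set (set (I -> R)) :=
  [set C | exists s A, [/\ uniq s, (forall i, measurable (A i)) & C = cylinder s A]].

Definition clocks := g_sigma_algebraType cylinders.

Definition set_clock (c : clocks) (j : I) (x : R) : clocks :=
  fun i => if i == j then x else c i.

Lemma cylindersI : setI_closed cylinders.
Proof.
move=> _ _ [s [A [us mA ->]]] [t [B [ut mB ->]]].
exists (undup (s ++ t)), (fun i => (if i \in s then A i else setT) `&`
   (if i \in t then B i else setT)); split.
- exact: undup_uniq.
- by move=> i; apply: measurableI; case: ifP.
- apply/seteqP; split => c /=.
    by move=> [sA tB] i _; split; case: ifPn => // ?; [exact: sA|exact: tB].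
  move=> H; split => i ii; have := H i; rewrite mem_undup mem_cat ii ?orbT.
    by case.
  by case.
Qed.

Lemma measurable_cylinder (s : seq I) (A : I -> set R) :
  (forall i, measurable (A i)) -> measurable (cylinder s A : set clocks).
Proof.
move=> mA; apply: sub_sigma_algebra; exists (undup s), A; split => //.
  exact: undup_uniq.
by apply/seteqP; split => c /= H i; have := H i; rewrite mem_undup.
Qed.

Lemma measurable_clock (i : I) : measurable_fun setT (fun c : clocks => c i).
Proof.
move=> _ B mB; rewrite setTI.
rewrite (_ : _ @^-1` _ = cylinder [:: i] (fun=> B)); first exact: measurable_cylinder.
by apply/seteqP; split => c /= H; [move=> j /[!inE]/eqP->|apply: H; rewrite inE].
Qed.

(** A map into the product is measurable as soon as its coordinates are. *)
Lemma measurable_clocks d (T : measurableType d) (f : T -> clocks) :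
  (forall i, measurable_fun setT (fun x => f x i)) -> measurable_fun setT f.
Proof.
move=> mf; refine (@measurability _ _ T clocks setT f cylinders erefl _).
move=> _ [_ [s [A [us mA ->]]] <-]; rewrite setTI.
rewrite (_ : _ @^-1` _ = \big[setI/setT]_(i <- s) ((fun x => f x i) @^-1` A i)).
  apply: big_ind => //; first exact: measurableI.
  by move=> i _; rewrite -(setTI (_ @^-1` _)); exact: mf.
rewrite -(bigcap_seq s (fun i => (fun x => f x i) @^-1` A i)); apply/seteqP.
by split => x /= H i; [move=> /= ii|move=> ii]; exact: (H i).
Qed.

End clock_space.
Arguments clocks : clear implicits.

Section resampling.
Context {I : choiceType} {R : realType} (nu : probability (measurableTypeR R) R)
  (Q : probability (clocks I R) R).
Hypothesis QE : forall (s : seq I) (A : I -> set R), uniq s ->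
  (forall i, measurable (A i)) -> Q (cylinder s A) = (\prod_(i <- s) nu (A i))%E.
Local Open Scope ereal_scope.
Local Notation E := (measurableTypeR R).

Lemma measurable_set_clock (j : I) :
  measurable_fun setT (fun p : E * clocks I R => set_clock p.2 j p.1).
Proof.
apply: measurable_clocks => i; rewrite /set_clock; case: eqP => _.
  exact: (@measurable_fst _ _ E (clocks I R)).
by apply: (measurableT_comp (measurable_clock i)); exact: measurable_snd.
Qed.

Lemma measurable_set_clock_at (j : I) (x : R) :
  measurable_fun setT (fun c : clocks I R => set_clock c j x).
Proof.
apply: measurable_clocks => i; rewrite /set_clock; case: eqP => _.
  exact: measurable_cst.
exact: measurable_clock.
Qed.

(** Both measures agree on cylinders: replacing the coordinate j of a cylinder
    splits it into a condition on the new value and a cylinder on the other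
    coordinates, and independence gives the same product on both sides. *)
Lemma resample_measure (j : I) (A : set (clocks I R)) : measurable A ->
  pushforward (nu \x Q) (fun p : E * clocks I R => set_clock p.2 j p.1) A = Q A.
Proof.
move=> mA; pose setj := fun p : E * clocks I R => set_clock p.2 j p.1.
have mj : measurable_fun setT setj := measurable_set_clock j.
pose mu : {measure set (clocks I R) -> \bar R} := pushforward (nu \x Q) setj.
refine (@measure_unique _ R (clocks I R) (@cylinders I R) (fun=> setT) erefl
  _ _ _ (mu mj) Q _ _ A _) => //.
- exact: cylindersI.
- by move=> _; exists [::], (fun=> setT); split => //; apply/seteqP.
- by rewrite bigcup_const.
- move=> _ [s [B [us mB ->]]].
  (* The cylinder is rewritten so that j is its first coordinate, with the
     trivial condition setT if it was not constrained. *)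
  pose s' := j :: rem j s.
  pose B' i := if i == j then (if j \in s then B j else setT) else B i.
  have us' : uniq s' by rewrite /s' /= rem_uniq// mem_rem_uniqF.
  have mB' i : measurable (B' i) by rewrite /B'; case: ifP => // _; case: ifP.
  have BE : cylinder s B = cylinder s' B'.
    apply/seteqP; split => c /= H i.
      rewrite /s' inE /B'; case: eqP => [-> _|ij /= irs].
        by case: ifPn => // js; exact: H.
      by apply: H; exact: mem_rem irs.
    move=> ii; have := H i; rewrite /s' inE /B'; case: eqP => [ij|/eqP ij].
      by rewrite ij in ii *; rewrite ii; exact.
    by apply; rewrite mem_rem_uniq// !inE ij.
  rewrite BE; apply: etrans (esym (QE us' mB')).
  rewrite big_cons /mu /= /pushforward.
  have -> : setj @^-1` cylinder s' B' = B' j `*` cylinder (rem j s) B'.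
    apply/seteqP; split => -[x c] /=; rewrite /setj /set_clock /=.
      move=> H; split; first by have := H j; rewrite eqxx inE eqxx; exact.
      move=> i ii; have := H i; rewrite /s' inE ii orbT; have [ij|_] := eqVneq i j; last exact.
      by move: ii; rewrite ij mem_rem_uniqF.
    move=> [H1 H2] i; rewrite inE; have [->//|ij /= ii] := eqVneq i j.
    exact: H2.
  rewrite product_measure1E; [|exact: mB'|exact: measurable_cylinder].
  by congr (_ * _); apply: QE => //; exact: rem_uniq.
- move=> k; have : (nu \x Q) (setT `*` setT) < +oo; last by rewrite setXTT.
  by rewrite product_measure1E//= !probability_setT mule1 ltry.
Qed.

(** The elementary form in which independence is used: one clock is integrated
    out, all the others being kept. *)
Lemma resample (j : I) (f : clocks I R -> \bar R) : measurable_fun setT f ->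
  (forall c, 0 <= f c) ->
  \int[Q]_c f c = \int[nu]_x \int[Q]_c f (set_clock c j x).
Proof.
move=> mf f0.
have mj := measurable_set_clock j.
rewrite -(fubini_tonelli1 (fun p : E * clocks I R => f (set_clock p.2 j p.1)))//; last first.
  exact: measurableT_comp.
rewrite -[RHS](ge0_integral_pushforward mj (nu \x Q) measurableT)//.
by apply: eq_measure_integral => A mA _; exact/esym/resample_measure.
Qed.

End resampling.

(** * Exponential clocks and the lack of memory *)
Section density.
Local Open Scope ereal_scope.
Context d (T : measurableType d) (R : realType).
Variables (mu nu : {measure set T -> \bar R}) (g : T -> R).
Hypotheses (mg : measurable_fun setT g) (g0 : forall x, (0 <= g x)%R).
Hypothesis nuE : forall A, measurable A -> nu A = \int[mu]_(x in A) (g x)%:E.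
Import HBNNSimple.

Let integral_density_nnsfun (f : {nnsfun T >-> R}) :
  \int[nu]_x (f x)%:E = \int[mu]_x ((f x)%:E * (g x)%:E).
Proof.
under [LHS]eq_integral do rewrite fimfunE -fsumEFin//.
rewrite [LHS]ge0_integral_fsum//; last 2 first.
  - by move=> r; exact/measurable_EFinP/measurableT_comp.
  - by move=> n x _; rewrite EFinM nnfun_muleindic_ge0.
under [RHS]eq_integral.
  move=> x xD; rewrite fimfunE -fsumEFin// muleC ge0_mule_fsumr; last first.
    by move=> r; rewrite EFinM nnfun_muleindic_ge0.
  over.
rewrite [RHS]ge0_integral_fsum//; last 2 first.
  - move=> r; apply: emeasurable_funM; first exact/measurable_EFinP.
    by apply/measurable_EFinP/measurableT_comp.
  - by move=> n x _; apply: mule_ge0; [rewrite lee_fin|rewrite EFinM nnfun_muleindic_ge0].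
apply: eq_fsbigr => r rf; rewrite integralZl_indic_nnsfun// integral_indic// setIT nuE//.
have r0 : (0 <= r)%R by move: rf; rewrite inE => -[x _ <-].
transitivity (\int[mu]_x (r%:E * ((g x)%:E * (\1_(f @^-1` [set r]) x)%:E))); last first.
  by apply: eq_integral => x _; rewrite EFinM muleCA.
rewrite ge0_integralZl//; last 2 first.
  - by apply: emeasurable_funM; exact/measurable_EFinP.
  - by move=> x _; rewrite -EFinM lee_fin mulr_ge0// indicE.
congr (_ * _); rewrite integral_mkcond; apply: eq_integral => x _.
by rewrite patchE indicE; case: ifP => _; rewrite ?mule1 ?mule0.
Qed.

Lemma ge0_integral_density (f : T -> \bar R) :
  measurable_fun setT f -> (forall x, 0 <= f x) ->
  \int[nu]_x f x = \int[mu]_x (f x * (g x)%:E).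
Proof.
move=> mf f0.
pose f_ := nnsfun_approx measurableT mf.
have f_cvg x : limn (fun n => (f_ n x)%:E) = f x.
  by apply/cvg_lim => //; exact: cvg_nnsfun_approx.
transitivity (limn (fun n => \int[nu]_x (f_ n x)%:E)).
  rewrite -monotone_convergence//=.
  - by apply: eq_integral => x _; rewrite f_cvg.
  - by move=> n; exact/measurable_EFinP/measurable_funTS.
  - by move=> n ? _; rewrite lee_fin.
  - by move=> ? _ ? ? mn; rewrite lee_fin; exact/lefP/nd_nnsfun_approx.
rewrite [RHS](_ : _ = limn (fun n => \int[mu]_x ((f_ n x)%:E * (g x)%:E))).
  by apply: congr_lim; apply/funext => n /=; exact: integral_density_nnsfun.
rewrite -monotone_convergence//=.
- apply: eq_integral => x _; rewrite limeMr// ?f_cvg//.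
  exact: cvg_nnsfun_approx.
- move=> n; apply/measurable_EFinP; exact: measurable_funM.
- by move=> n ? _; rewrite -EFinM lee_fin mulr_ge0.
- by move=> x _ n m nm; rewrite lee_wpmul2r ?lee_fin//; exact/lefP/nd_nnsfun_approx.
Qed.

End density.

Section expo.
Local Open Scope ereal_scope.
Context {R : realType}.
Local Notation E := (measurableTypeR R).
Local Notation leb := (@lebesgue_measure R).

Definition expo : probability E R :=
  @exponential_distribution_exponential_prob__canonical__probability_measure_Probability R 1 ltr01.

Lemma ge0_integral_translation (x : R) (f : R -> \bar R) :
  measurable_fun setT f -> (forall y, 0 <= f y) ->
  \int[leb]_y f y = \int[leb]_y f (x + y)%R.
Proof.
move=> mf f0.
have mx : measurable_fun setT ((fun y => x + y)%R : E -> E).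
  exact: (measurable_funD (measurable_cst x) (@measurable_id _ E setT)).
transitivity (\int[pushforward leb ((fun y => x + y)%R : E -> E)]_y f y); last first.
  by rewrite ge0_integral_pushforward.
apply: eq_measure_integral => A mA _.
apply: lebesgue_measure_unique => //= _ [[a b]] _ <-.
rewrite /pushforward (_ : _ @^-1` _ = `](a - x)%R, (b - x)%R]%classic).
  rewrite !lebesgue_measure_itv/= !lte_fin ltrD2r.
  by case: ifP => // _; rewrite -!EFinD; congr (_%:E); ring.
by apply/seteqP; split => y /=; rewrite !in_itv/= ltrBlDl lerBrDl.
Qed.

Lemma ge0_integral_expo (f : R -> \bar R) :
  measurable_fun setT f -> (forall x, 0 <= f x) ->
  \int[expo]_x f x = \int[leb]_(x in `[0%R, +oo[) (f x * (expR (- x))%:E).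
Proof.
move=> mf f0.
rewrite (@ge0_integral_density _ E R leb expo (exponential_pdf 1))//; last 2 first.
- exact: measurable_exponential_pdf.
- by move=> x; exact: exponential_pdf_ge0.
rewrite [RHS]integral_mkcond; apply: eq_integral => x _.
rewrite patchE /exponential_pdf patchE; case: ifP => _; last by rewrite mule0.
by rewrite mul1r mulN1r.
Qed.

Lemma expo_null1 (x : R) : expo [set x] = 0.
Proof.
rewrite /expo /= /exponential_prob null_set_integral//.
- apply: measurable_funTS; apply/measurable_EFinP; exact: measurable_exponential_pdf.
- by rewrite /= lebesgue_measure_set1.
Qed.

(** Lack of memory for one clock. The boolean chooses between the strict and the
    large inequality, which differ on a null set; both occur because ties between
    clocks are resolved by the order of the balls. *)
Lemma ge0_integral_expo_shift (x : R) (b : bool) (f : R -> \bar R) : (0 <= x)%R ->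
  measurable_fun setT f -> (forall y, 0 <= f y) ->
  \int[expo]_y (if (x < y ?<= if b)%R then f y else 0) =
  (expR (- x))%:E * \int[expo]_y f (x + y)%R.
Proof.
move=> x0 mf f0.
have mif b' : measurable_fun setT (fun y : R => if (x < y ?<= if b')%R then f y else 0).
  apply: measurable_fun_ifT => //.
  case: b' => /=; [exact: measurable_fun_ler|exact: measurable_fun_ltr].
have mfx : measurable_fun setT (fun y : R => f (x + y)%R).
  by apply: measurableT_comp => //; exact: measurable_funD.
transitivity (\int[expo]_y (if (x <= y)%R then f y else 0)).
  apply: ge0_ae_eq_integral => //.
  - exact: (mif b).
  - exact: (mif true).
  - by move=> y _; case: ifP.
  - by move=> y _; case: ifP.
  - exists [set x]; split => //; [exact: expo_null1|].
    move=> y /=; rewrite -[y = x]/(y = x); apply: contra_notP => /eqP yx _.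
    rewrite /Order.lteif le_eqVlt eq_sym (negbTE yx) /=.
    by case: b.
rewrite ge0_integral_expo//; [|exact: (mif true)|by move=> y; case: ifP].
rewrite ge0_integral_expo// -ge0_integralZl//; last 2 first.
- by apply: measurable_funTS; apply: emeasurable_funM => //; exact/measurable_EFinP/measurableT_comp.
- by move=> y _; rewrite mule_ge0// lee_fin expR_ge0.
rewrite [LHS]integral_mkcond [LHS](ge0_integral_translation x)//; last 2 first.
- apply: (iffLR (measurable_restrictT _ _)) => //; apply: measurable_funTS; apply: emeasurable_funM.
    exact: (mif true).
  exact/measurable_EFinP/measurableT_comp.
- by move=> y; rewrite patchE; case: ifP => // _; rewrite mule_ge0 ?lee_fin ?expR_ge0//; case: ifP.
rewrite [RHS]integral_mkcond; apply: eq_integral => y _; rewrite !patchE.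
have -> : ((x + y)%R \in `[0%R, +oo[%classic) = (0 <= x + y)%R.
  by apply/idP/idP; rewrite inE/= in_itv/= andbT.
have -> : (y \in `[0%R, +oo[%classic) = (0 <= y)%R.
  by apply/idP/idP; rewrite inE/= in_itv/= andbT.
rewrite lerDl; have [y0|y0] := boolP (0 <= y)%R.
  by rewrite addr_ge0// opprD expRD EFinM muleCA.
case: (0 <= x + y)%R; rewrite ?mul0e; exact: erefl.
Qed.

End expo.

Section memoryless.
Local Open Scope ereal_scope.
Context {I : choiceType} {R : realType} (Q : probability (clocks I R) R).
Local Notation E := (measurableTypeR R).
Hypothesis QE : forall (s : seq I) (A : I -> set R), uniq s ->
  (forall i, measurable (A i)) -> Q (cylinder s A) = (\prod_(i <- s) expo (A i))%E.

Definition delay (J : seq I) (x : R) (c : clocks I R) : clocks I R :=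
  fun i => if i \in J then (x + c i)%R else c i.

Lemma measurable_all_later (J : seq I) (b : I -> bool) (x : R) :
  measurable_fun setT (fun c : clocks I R => all (fun j => x < c j ?<= if b j)%R J).
Proof.
elim: J => [|j J IH] /=; first exact: measurable_cst.
apply: measurable_and => //.
case: (b j) => /=; [apply: measurable_fun_ler|apply: measurable_fun_ltr] => //;
    exact: measurable_clock.
Qed.

(** Induction on J: integrating out one clock of J by [resample] reduces the
    claim to [ge0_integral_expo_shift]; resampling backwards turns the integral
    over the shifted fresh value into a shift of that clock. *)
Lemma memoryless (x : R) (J : seq I) (b : I -> bool) (f : clocks I R -> \bar R) :
  (0 <= x)%R -> uniq J -> measurable_fun setT f -> (forall c, 0 <= f c) ->
  \int[Q]_c (if all (fun j => x < c j ?<= if b j)%R J then f c else 0) =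
  (expR (- (x *+ size J)))%:E * \int[Q]_c f (delay J x c).
Proof.
move=> x0; elim: J f => [|j J IH] f /=; first by rewrite mulr0n oppr0 expR0 mul1e.
move=> /andP[jJ uJ] mf f0.
pose g (c : clocks I R) := if all (fun j => x < c j ?<= if b j)%R J then f c else 0.
have mg : measurable_fun setT g.
  by apply: measurable_fun_ifT => //; exact: measurable_all_later.
have g0 c : 0 <= g c by rewrite /g; case: ifP.
pose upd (c : clocks I R) := set_clock c j (x + c j)%R.
have mupd : measurable_fun setT upd.
  apply: measurable_clocks => i; rewrite /upd /set_clock; case: eqP => _.
    by apply: measurable_funD => //; exact: measurable_clock.
  exact: measurable_clock.
have mgs : measurable_fun setT (fun p : E * clocks I R => g (set_clock p.2 j p.1)).
  by apply: measurableT_comp => //; exact: measurable_set_clock.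
transitivity (\int[Q]_c (if (x < c j ?<= if b j)%R then g c else 0)).
  by apply: eq_integral => c _; rewrite /g; case: (x < c j ?<= if b j)%R.
rewrite (resample QE j); last 2 first.
- apply: measurable_fun_ifT => //.
  case: (b j) => /=; [apply: measurable_fun_ler|apply: measurable_fun_ltr] => //;
    exact: measurable_clock.
- by move=> c; case: ifP.
pose G y := \int[Q]_c g (set_clock c j y).
have mG : measurable_fun setT (G : E -> \bar R).
  exact: (measurable_fun_fubini_tonelli_F _ mgs).
have G0 y : 0 <= G y by apply: integral_ge0.
transitivity (\int[expo]_y (if (x < y ?<= if b j)%R then G y else 0)).
  apply: eq_integral => y _; rewrite /set_clock eqxx; case: ifP => // _.
  by rewrite integral0.
rewrite ge0_integral_expo_shift//.
transitivity ((expR (- x))%:E * \int[Q]_c g (upd c)).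
  congr (_ * _); rewrite (resample QE j (f := g \o upd));
    [|exact: (measurableT_comp mg mupd)|by move=> c /=; exact: g0].
  apply: eq_integral => y _; apply: eq_integral => c _ /=; congr g.
  by apply/funext => i; rewrite /upd /set_clock eqxx; case: ifP.
rewrite mulrS opprD expRD EFinM -muleA; congr (_ * _).
transitivity (\int[Q]_c (if all (fun j => x < c j ?<= if b j)%R J then (f \o upd) c else 0)).
  apply: eq_integral => c _; rewrite /g /=; congr (if _ then _ else _).
  apply: eq_in_all => i iJ; rewrite /upd /set_clock ifF//.
  by apply: contraNF jJ => /eqP <-.
rewrite (IH (f \o upd) uJ); [|exact: (measurableT_comp mf mupd)|by move=> c /=; exact: f0].
congr (_ * _); apply: eq_integral => c _ /=; congr f.
apply/funext => i; by rewrite /upd /set_clock /delay inE (negbTE jJ); case: eqP => //= ->.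
Qed.

End memoryless.

(** * One draw of the urn *)
Section draw_at.
Variable a : nat.

(** The transition of the urn when the position of the drawn ball is known. It is
    polymorphic in the balls: it is used for urns of ringing times, of labels of
    clocks, and of random variables, and commutes with maps between them. *)
Definition draw_at {A : Type} (x0 : A) (new : nat -> A) (i : nat)
    (u : seq A * seq A) : seq A * seq A :=
  let l := set_nth x0 (u.1 ++ u.2) i (new 0%N) in
  let: (w, b) := (take (size u.1) l, drop (size u.1) l) in
  if (i < size u.1)%N then (drop a w, drop a b)
  else (w ++ mkseq (fun k => new k.+1) a, b ++ mkseq (fun k => new (a + k).+1) a).

Definition map_urn {A B : Type} (f : A -> B) (u : seq A * seq A) : seq B * seq B :=
  (map f u.1, map f u.2).

Lemma map_set_nth {A B : Type} (f : A -> B) x0 l i x :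
  map f (set_nth x0 l i x) = set_nth (f x0) (map f l) i (f x).
Proof.
elim: l i => [|y l IH] [|i] //=; last by rewrite IH.
by congr (_ :: _); elim: i => //= i ->.
Qed.

Lemma map_draw_at {A B : Type} (f : A -> B) x0 new i u :
  map_urn f (draw_at x0 new i u) = draw_at (f x0) (f \o new) i (map_urn f u).
Proof.
rewrite /draw_at /map_urn /= size_map -map_cat -map_set_nth.
case: ifP => _ /=; rewrite ?map_cat !(map_take, map_drop)//.
by rewrite -!map_comp.
Qed.

Lemma eq_draw_at {A : Type} (x0 : A) new new' i u :
  new =1 new' -> draw_at x0 new i u = draw_at x0 new' i u.
Proof. by move=> /funext ->. Qed.

Lemma size_draw_at {A : Type} (x0 : A) new i u : (i < size (u.1 ++ u.2))%N ->
  let v := draw_at x0 new i u in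
  if (i < size u.1)%N then size v.1 = (size u.1 - a)%N /\ size v.2 = (size u.2 - a)%N
  else size v.1 = (size u.1 + a)%N /\ size v.2 = (size u.2 + a)%N.
Proof.
move=> iu /=; rewrite /draw_at.
have sl : size (set_nth x0 (u.1 ++ u.2) i (new 0%N)) = (size u.1 + size u.2)%N.
  by rewrite size_set_nth (maxn_idPr iu) size_cat.
case: (i < size u.1)%N => /=.
  rewrite !size_drop sl size_take sl.
  by case: ltnP => ?; split; lia.
rewrite !size_cat !size_mkseq size_drop sl size_take sl.
by case: ltnP => ?; split; lia.
Qed.

End draw_at.

Section next_ring.
Context {R : realType}.

Lemma next_ring_le (u : seq R * seq R) x : x \in u.1 ++ u.2 -> next_ring u <= x.
Proof.
rewrite /next_ring; move: (u.1 ++ u.2) => l; move: (head 0 l) => h.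
elim: l => //= y l IH; rewrite inE ge_min => /orP[/eqP->|/IH ->]; by rewrite ?lexx ?orbT.
Qed.

Lemma next_ring_mem (u : seq R * seq R) : (0 < size (u.1 ++ u.2))%N ->
  next_ring u \in u.1 ++ u.2.
Proof.
rewrite /next_ring; move: (u.1 ++ u.2) => [//|x l] _ /=.
suff : Num.min x (foldr Num.min x l) \in x :: l by [].
have : foldr Num.min x l \in x :: l.
  elim: l => [|y l IH] /=; first by rewrite inE.
  rewrite minElt; case: ifP => _; first by rewrite !inE eqxx orbT.
  by move: IH; rewrite !inE => /orP[->//|->]; rewrite !orbT.
by rewrite minElt; case: ifP => // _ _; rewrite inE eqxx.
Qed.

Lemma nth_next_ring (u : seq R * seq R) :
  nth 0 (u.1 ++ u.2) (index (next_ring u) (u.1 ++ u.2)) = next_ring u.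
Proof.
have [|] := posnP (size (u.1 ++ u.2)); last by move=> /next_ring_mem /nth_index ->.
by rewrite /next_ring => /size0nil ->.
Qed.

(** For clocks with distinct labels, the ball j is drawn exactly when its clock is
    before those of the balls preceding it, strictly, and not after the others:
    this is the form of event handled by [memoryless]. *)
Lemma index_next_ring (A : eqType) (v : A -> R) (L : seq A * seq A) (j : A) :
  let l := L.1 ++ L.2 in uniq l -> j \in l ->
  (index (next_ring (map_urn v L)) (map v l) == index j l) =
  all (fun k => v j < v k ?<= if (index j l < index k l)%N) (rem j l).
Proof.
set l := L.1 ++ L.2 => /= ul jl.
set m := next_ring _.
have mu : (map_urn v L).1 ++ (map_urn v L).2 = map v l by rewrite /= -map_cat.
have mmin k : k \in l -> m <= v k.
  by move=> kl; apply: next_ring_le; rewrite mu; apply: map_f.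
have min : m \in map v l.
  by rewrite -mu; apply: next_ring_mem; rewrite mu size_map; case: (l) jl.
have jsz : (index j l < size l)%N by rewrite index_mem.
apply/idP/idP => [/eqP ij|/allP H].
  have mj : m = v j.
    have := nth_index 0 min; rewrite ij (nth_map j)// nth_index// => ->//.
  apply/allP => k krem; have kl := mem_rem krem.
  have kj : k != j by apply: contraTneq krem => ->; rewrite mem_rem_uniqF.
  have [jk|kj'|/eqP] := ltngtP (index j l) (index k l).
  - by rewrite -mj /= mmin.
  - rewrite /= lt_neqAle -mj mmin// andbT; apply/eqP => mk.
    have := kj'; rewrite -ij ltnNge => /negP; apply.
    have : index m (map v l) = find (pred1 m) (map v l) by [].
    move=> ->; rewrite leqNgt; apply/negP => /(before_find 0) /=.
    by rewrite (nth_map j) ?index_mem// nth_index// mk eqxx.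
  - move=> /eqP /(congr1 (nth j l)); rewrite !nth_index// => jk.
    by rewrite jk eqxx in kj.
have mj : m = v j.
  apply/eqP; rewrite eq_le mmin//=.
  case/mapP: (min) => k kl ->; have [->//|kj] := eqVneq k j.
  by apply: (lteifW (C := (index j l < index k l)%N)); apply: H; rewrite mem_rem_uniq// !inE kj.
apply/eqP/anti_leq/andP; split.
  rewrite leqNgt; apply/negP => /(before_find 0) /=.
  by rewrite (nth_map j)// nth_index// mj eqxx.
rewrite leqNgt; apply/negP => lt.
have iml : (index m (map v l) < size l)%N by rewrite -(size_map v) index_mem.
set k := nth j l (index m (map v l)).
have ki : index k l = index m (map v l) by rewrite /k index_uniq.
have kj : k != j by apply: contraTneq lt => <-; rewrite ki ltnn.
have /H : k \in rem j l by rewrite mem_rem_uniq// !inE kj /= mem_nth.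
rewrite ki ltnNge (ltnW lt) /= => vjk.
by have := nth_index 0 min; rewrite (nth_map j)// -/k mj => vkj; rewrite vkj ltxx in vjk.
Qed.

End next_ring.

(** * Payoff of the stopped urn *)
Section stopped.
Context {R : realType} (a : nat) (H : nat -> R -> nat -> \bar R) (t : R).
Hypothesis a0 : (0 < a)%N.
Local Notation M := (constant_differentials_mx a).
Local Notation label := (nat * nat)%type.

(** The urn runs from epoch n, reached at time s, until the first of m further
    epochs and time t; the payoff is then H of the number of epochs, the time and
    the number of white balls. *)
Fixpoint stopped (m n : nat) (s : R) (u : seq R * seq R) (c : label -> R) : \bar R :=
  if m is m'.+1 then
    let s' := next_ring u in
    if s' <= t then stopped m' n.+1 s' (draw M c n.+1 u) c else H n t (size u.1)
  else H n s (size u.1).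

Lemma drawE (c : label -> R) (n : nat) (u : seq R * seq R) :
  draw M c n u = draw_at a 0 (fun k => next_ring u + c (n, k))
    (index (next_ring u) (u.1 ++ u.2)) u.
Proof.
rewrite /draw /draw_at; set i := index _ _.
case: ifP => iu; rewrite !mxE /=.
  by case: a a0 => //= a' _; rewrite !subn0.
by [].
Qed.

(** The future of the urn after epoch n depends only on clocks started later. *)
Lemma stopped_ext m n s u c c' : (forall i k, (n < i)%N -> c (i, k) = c' (i, k)) ->
  stopped m n s u c = stopped m n s u c'.
Proof.
elim: m n s u => [//|m IH] n s u cc /=.
rewrite (IH n.+1 _ _); last by move=> i k ni; apply: cc; exact: ltnW.
case: ifP => // _; congr (stopped _ _ _ _ _).
by rewrite !drawE; apply: eq_draw_at => k; rewrite cc.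
Qed.

End stopped.

(** Which alternative holds does not depend on the payoff, so that several payoffs
    can be compared on the same path. *)
Lemma stopped_urn_after {R : realType} (a : nat) (t : R) m n w0 b0 c :
  let e := epoch (constant_differentials_mx a) w0 b0 c in
  let u := urn_after (constant_differentials_mx a) w0 b0 c in
  e n <= t ->
  (e (n + m)%N <= t /\ forall H, stopped a H t m n (e n) (u n) c =
     H (n + m)%N (e (n + m)%N) (size (u (n + m)%N).1)) \/
  exists2 j, e j <= t < e j.+1 &
    (j < n + m)%N /\ forall H, stopped a H t m n (e n) (u n) c = H j t (size (u j).1).
Proof.
move=> e u; elim: m n => [|m IH] n en /=; first by rewrite addn0; left.
have [en1|en1] := leP (next_ring (u n)) t.
  have := IH n.+1 en1; rewrite addSnnS /= => -[[]|[j ej [jn vj]]]; first by left.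
  by right; exists j.
right; exists n; first by rewrite en.
by rewrite addnS ltnS leq_addr.
Qed.

Section measurable_stopped.
Local Open Scope ereal_scope.
Context {R : realType} (a : nat) (H : nat -> R -> nat -> \bar R) (t : R).
Hypothesis a0 : (0 < a)%N.
Hypothesis mH : forall n w, measurable_fun setT (fun s => H n s w).
Local Notation M := (constant_differentials_mx a).
Local Notation label := (nat * nat)%type.
Local Notation C := (clocks label R).

(** The default value of [nth] is the null function, so that no bound on the
    position is needed. *)
Definition mlist (l : seq (C -> R)) := forall i, measurable_fun setT (nth (fun=> 0%R) l i).

Lemma mlist_cat l1 l2 : mlist l1 -> mlist l2 -> mlist (l1 ++ l2).
Proof. by move=> m1 m2 i; rewrite nth_cat; case: ifP. Qed.

Lemma mlist_drop k l : mlist l -> mlist (drop k l).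
Proof. by move=> ml i; rewrite nth_drop. Qed.

Lemma mlist_take k l : mlist l -> mlist (take k l).
Proof.
move=> ml i; have [ik|ki] := ltnP i k; first by rewrite nth_take.
by rewrite nth_default ?size_take_min ?geq_min ?ki//; exact: measurable_cst.
Qed.

Lemma mlist_set_nth l k f : mlist l -> measurable_fun setT f ->
  mlist (set_nth (fun=> 0%R) l k f).
Proof. by move=> ml mf i; rewrite nth_set_nth /=; case: ifP. Qed.

Lemma mlist_mkseq (f : nat -> C -> R) k : (forall i, measurable_fun setT (f i)) ->
  mlist (mkseq f k).
Proof.
move=> mf i; have [ik|ki] := ltnP i k; first by rewrite nth_mkseq.
by rewrite nth_default ?size_mkseq//; exact: measurable_cst.
Qed.

Lemma mlist_draw_at (new : nat -> C -> R) i F :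
  (forall k, measurable_fun setT (new k)) -> mlist F.1 -> mlist F.2 ->
  mlist (draw_at a (fun=> 0%R) new i F).1 /\ mlist (draw_at a (fun=> 0%R) new i F).2.
Proof.
move=> mnew m1 m2; rewrite /draw_at.
have ml : mlist (set_nth (fun=> 0%R) (F.1 ++ F.2) i (new 0%N)).
  by apply: mlist_set_nth => //; exact: mlist_cat.
case: (i < size F.1)%N => /=; split.
- by do 2 apply: mlist_drop || apply: mlist_take.
- by do 2 apply: mlist_drop || apply: mlist_take.
- by apply: mlist_cat; [exact: mlist_take|exact: mlist_mkseq].
- by apply: mlist_cat; [exact: mlist_drop|exact: mlist_mkseq].
Qed.

Definition eval_urn (F : seq (C -> R) * seq (C -> R)) (c : C) := map_urn (fun f => f c) F.

Lemma measurable_next_ring F : mlist F.1 -> mlist F.2 ->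
  measurable_fun setT (fun c : C => next_ring (eval_urn F c)).
Proof.
move=> m1 m2; rewrite (_ : (fun c => _) = fun c : C =>
  foldr Num.min (head 0%R [seq f c | f <- F.1 ++ F.2]) [seq f c | f <- F.1 ++ F.2]); last first.
  by apply/funext => c; rewrite /next_ring /= -map_cat.
have := mlist_cat m1 m2; move: (F.1 ++ F.2) => l ml.
have mh : measurable_fun setT (fun c : C => head 0%R [seq f c | f <- l]).
  by rewrite (_ : (fun c => _) = nth (fun=> 0%R) l 0)//; case: (l).
suff key (h : C -> R) : measurable_fun setT h -> measurable_fun setT
    (fun c : C => foldr Num.min (h c) [seq f c | f <- l]) by exact: key mh.
move=> {}mh; elim: l ml => [//|f l IH] ml /=.
apply: measurable_minr; first exact: (ml 0%N).
by apply: IH => // i; exact: (ml i.+1).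
Qed.

Lemma measurable_index l (g : C -> R) : mlist l -> measurable_fun setT g ->
  measurable_fun setT (fun c : C => index (g c) [seq f c | f <- l]).
Proof.
move=> + mg; elim: l => [|f l IH] ml /=; first exact: measurable_cst.
apply: measurable_fun_ifT => //.
- by apply: measurable_fun_eqr => //; exact: (ml 0%N).
- by apply: (measurableT_comp (f := S)) => //; apply: IH => i; exact: (ml i.+1).
Qed.

(** The drawn position takes finitely many values, and once it is known the next
    urn is again a list of measurable functions of the clocks. *)
Lemma measurable_stopped m n S F : measurable_fun setT S -> mlist F.1 -> mlist F.2 ->
  measurable_fun setT (fun c : C => stopped a H t m n (S c) (eval_urn F c) c).
Proof.
elim: m n S F => [|m IH] n S F mS m1 m2 /=.
  rewrite (_ : (fun c => _) = (fun c : C => H n (S c) (size F.1))); last first.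
    by apply/funext => c; rewrite size_map.
  by apply: (measurableT_comp (f := fun s => H n s (size F.1))).
pose l := F.1 ++ F.2; have ml : mlist l by exact: mlist_cat.
pose idx (c : C) := index (next_ring (eval_urn F c)) [seq f c | f <- l].
pose Fi i := nth (fun=> 0%R) l i.
pose new i k (c : C) := (Fi i c + c (n.+1, k))%R.
pose step i (c : C) := if (Fi i c <= t)%R then
  stopped a H t m n.+1 (Fi i c) (eval_urn (draw_at a (fun=> 0%R) (new i) i F) c) c
  else H n t (size F.1).
(* One more position than there are balls: in an empty urn the drawn position
   is 0. *)
rewrite (_ : (fun c => _) = (fun c : C =>
  \sum_(i < (size l).+1) if idx c == i then step i c else 0)).
  apply: emeasurable_sum => i; apply: measurable_fun_ifT.
  - apply: (measurableT_comp (f := fun k : nat => k == i)) => //.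
    by apply: measurable_index => //; exact: measurable_next_ring.
  - have mnew k : measurable_fun setT (new i k).
      by apply: measurable_funD; [exact: ml|exact: measurable_clock].
    have [md1 md2] := mlist_draw_at i mnew m1 m2.
    apply: measurable_fun_ifT => //.
      by apply: measurable_fun_ler => //; exact: ml.
    by apply: IH => //; exact: ml.
  - exact: measurable_cst.
apply/funext => c.
have ltidx : (idx c < (size l).+1)%N by rewrite ltnS -(size_map (fun f => f c)) index_size.
rewrite (bigD1 (Ordinal ltidx))//= eqxx big1 ?adde0; last first.
  move=> i; rewrite -val_eqE /= => /negbTE; rewrite eq_sym => -> //.
have Fidx : Fi (idx c) c = next_ring (eval_urn F c).
  rewrite -[RHS]nth_next_ring /eval_urn /= -map_cat -/l /idx /Fi.
  by elim: l (index _ _) {ml idx Fi new step ltidx} => [|f l IHl] [|i] //=.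
rewrite /step /= Fidx size_map drawE// /eval_urn map_draw_at; case: ifP => // _.
congr stopped; rewrite -map_cat -/l; apply: eq_draw_at => k /=.
by rewrite /new -/(idx c) Fidx.
Qed.

End measurable_stopped.

(** * Harmonic payoffs have constant expectation *)
Section draw_at_labels.
Variable a : nat.

(** The drawn ball is replaced, so neither its previous clock nor the default value
    matters. *)
Lemma draw_at_congr {A : Type} (x0 x0' : A) new new' i u u' :
  size u.1 = size u'.1 -> size u.2 = size u'.2 -> (i < size (u.1 ++ u.2))%N ->
  (forall k, k != i -> (k < size (u.1 ++ u.2))%N ->
    nth x0 (u.1 ++ u.2) k = nth x0 (u'.1 ++ u'.2) k) ->
  new =1 new' -> draw_at a x0 new i u = draw_at a x0' new' i u'.
Proof.
move=> s1 s2 iu uu' /funext <-; rewrite /draw_at -s1.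
have s12 : size (u.1 ++ u.2) = size (u'.1 ++ u'.2) by rewrite !size_cat s1 s2.
suff -> : set_nth x0 (u.1 ++ u.2) i (new 0%N) = set_nth x0' (u'.1 ++ u'.2) i (new 0%N) by [].
apply: (@eq_from_nth _ x0) => [|k]; rewrite !size_set_nth ?s12//.
rewrite -s12 (maxn_idPr iu) => ku.
rewrite nth_set_nth /= [RHS](set_nth_default x0'); last first.
  by rewrite size_set_nth -s12 (maxn_idPr iu).
rewrite nth_set_nth /=; case: eqVneq => // ki.
by rewrite uu'//; apply: set_nth_default; rewrite -s12.
Qed.

Lemma uniq_set_nth {A : eqType} (x0 y : A) l i : (i < size l)%N -> uniq l ->
  y \notin l -> uniq (set_nth x0 l i y).
Proof.
move=> il; rewrite set_nthE il -{1 2}(cat_take_drop i l) (drop_nth x0)//.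
rewrite !cat_uniq /= => /and3P[-> + /andP[_ ->]].
rewrite negb_or => /andP[_ ndrop].
by rewrite mem_cat inE !negb_or => /and3P[-> _ ->]; rewrite ndrop.
Qed.

Lemma fresh_label (n k : nat) (l : seq (nat * nat)) :
  (forall j, j \in l -> (j.1 <= n)%N) -> (n.+1, k) \notin l.
Proof. by move=> ln; apply/negP => /ln /=; rewrite ltnn. Qed.

(** Labels carry the epoch at which the clock was started, so those introduced at
    epoch n.+1 differ from all those already in the urn. *)
Lemma draw_at_fresh_labels (n i : nat) (L : seq (nat * nat) * seq (nat * nat)) :
  let l := L.1 ++ L.2 in let L' := draw_at a (0, 0)%N (fun k => (n.+1, k)) i L in
  (i < size l)%N -> uniq l -> (forall j, j \in l -> (j.1 <= n)%N) ->
  uniq (L'.1 ++ L'.2) /\ forall j, j \in L'.1 ++ L'.2 -> (j.1 <= n.+1)%N.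
Proof.
move=> l L' il ul ln; rewrite /L' /draw_at -/l.
set l' := set_nth _ _ _ _.
have ul' : uniq l' by apply: uniq_set_nth => //; exact: fresh_label.
have ll' j : j \in l' -> j = (n.+1, 0)%N \/ j \in l.
  rewrite /l' set_nthE il mem_cat inE => /orP[jt|/orP[/eqP->|jd]].
  - by right; exact: mem_take jt.
  - by left.
  - by right; exact: mem_drop jd.
case: (i < size L.1)%N => /=.
  have sub : subseq (drop a (take (size L.1) l') ++ drop a (drop (size L.1) l')) l'.
    by rewrite -{3}(cat_take_drop (size L.1) l') cat_subseq// drop_subseq.
  split; first exact: subseq_uniq sub ul'.
  by move=> j /(mem_subseq sub) /ll' [->//|/ln /leq_trans]; apply.
set w := mkseq _ _; set b := mkseq _ _.
have perm : perm_eq ((take (size L.1) l' ++ w) ++ drop (size L.1) l' ++ b)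
    (l' ++ mkseq (fun k => (n.+1, k.+1)) (a + a)).
  rewrite -{3}(cat_take_drop (size L.1) l') -!catA perm_cat2l.
  rewrite (_ : mkseq _ (a + a) = w ++ b); first by rewrite perm_catCA.
  by rewrite /w /b /mkseq iotaD map_cat add0n; congr cat; rewrite -[X in iota X]addn0 iotaDl -map_comp.
have new_mem j : j \in mkseq (fun k => (n.+1, k.+1)) (a + a) -> exists k, j = (n.+1, k.+1).
  by move=> /mapP[k _ ->]; exists k.
split.
  rewrite (perm_uniq perm) cat_uniq ul' /= map_inj_uniq ?iota_uniq ?andbT; last by move=> ? ? [].
  apply/hasPn => j /new_mem [k ->]; apply/negP => /ll' [//|].
  exact/negP/fresh_label.
move=> j; rewrite (perm_mem perm) mem_cat => /orP[/ll' [->//|/ln /leq_trans]|/new_mem [k ->]//].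
by apply.
Qed.

End draw_at_labels.

Lemma sume_const_seq {R : realType} {A : Type} (s : seq A) (y : \bar R) :
  (0 <= y)%E -> (\sum_(j <- s) y = (size s)%:R%:E * y)%E.
Proof.
move=> y0; elim: s => [|x s IH]; first by rewrite big_nil mul0e.
by rewrite big_cons IH /= -nat1r EFinD ge0_muleDl ?lee_fin// mul1e.
Qed.

Section stopped_integral.
Local Open Scope ereal_scope.
Context {R : realType} (a D : nat) (H : nat -> R -> nat -> \bar R) (t : R).
Hypotheses (a0 : (0 < a)%N) (D0 : (0 < D)%N).
Hypothesis mH : forall n w, measurable_fun setT (fun s => H n s w).
Hypothesis H0 : forall n s w, 0 <= H n s w.
Local Notation label := (nat * nat)%type.
Local Notation C := (clocks label R).
Local Notation leb := (@lebesgue_measure R).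
Variable Q : probability C R.
Hypothesis QE : forall (s : seq label) (A : label -> set R), uniq s ->
  (forall i, measurable (A i)) -> Q (cylinder s A) = (\prod_(i <- s) expo (A i))%E.

(** What is collected if the next epoch comes x after time s, summed over the balls
    that may be drawn; beyond t each ball contributes the final payoff. The expected
    payoff after one step is the integral of this sum against
    exp (- (w + (w + D)) x), the product of the density at x of the clock of the
    drawn ball and of the probability that the other clocks exceed x. *)
Definition one_step_payoff (n : nat) (s : R) (w : nat) (x : R) : \bar R :=
  if (s + x <= t)%R then
    w%:R%:E * H n.+1 (s + x)%R (w - a)%N + (w + D)%:R%:E * H n.+1 (s + x)%R (w + a)%N
  else (w + (w + D))%:R%:E * H n t w.

Hypothesis H_harmonic : forall n s w, (s <= t)%R -> (a %| w)%N ->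
  \int[leb]_(x in `[0%R, +oo[)
    (one_step_payoff n s w x * (expR (- (x *+ (w + (w + D)))))%:E) = H n s w.

(** The urn at time s whose ball of label j has been given a fresh clock c j. *)
Definition urn_at (s : R) (c : C) (L : seq label * seq label) :=
  map_urn (fun j => s + c j)%R L.

(** The payoff on the event that the ball j is drawn first. *)
Definition after_ring (m n : nat) (s : R) L (j : label) (c : C) : \bar R :=
  if (s + c j <= t)%R then
    stopped a H t m n.+1 (s + c j)%R
      (draw_at a 0%R (fun k => s + c j + c (n.+1, k))%R (index j (L.1 ++ L.2))
        (urn_at s c L)) c
  else H n t (size L.1).

Lemma stopped_ge0 m n s u c : 0 <= stopped a H t m n s u c.
Proof. by elim: m n s u => [|k IHk] n' s' u //=; case: ifP. Qed.

Lemma after_ring_ge0 m n s L j c : 0 <= after_ring m n s L j c.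
Proof. by rewrite /after_ring; case: ifP => // _; exact: stopped_ge0. Qed.

Definition ring_time (s : R) (j : label) (c : C) : R := s + c j.

Lemma measurable_ring_time s j : measurable_fun setT (ring_time s j).
Proof. by apply: measurable_funD => //; exact: measurable_clock. Qed.

Lemma mlist_ring_time s (L : seq label) : mlist (map (ring_time s) L).
Proof.
move=> i; have [ik|ki] := ltnP i (size L).
  by rewrite (nth_map (0, 0)%N)//; exact: measurable_ring_time.
by rewrite nth_default ?size_map//; exact: measurable_cst.
Qed.

Lemma eval_ring_time s c L : eval_urn (map_urn (ring_time s) L) c = urn_at s c L.
Proof. by rewrite /eval_urn /urn_at /map_urn /= -!map_comp. Qed.

Lemma measurable_after_ring m n s L j : measurable_fun setT (after_ring m n s L j).
Proof.
apply: measurable_fun_ifT => //.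
  by apply: measurable_fun_ler => //; exact: measurable_ring_time.
pose F := map_urn (ring_time s) L.
pose new k (c : C) := (s + c j + c (n.+1, k))%R.
rewrite (_ : (fun c => _) = (fun c : C => stopped a H t m n.+1 (ring_time s j c)
  (eval_urn (draw_at a (fun=> 0%R) new (index j (L.1 ++ L.2)) F) c) c)); last first.
  by apply/funext => c; congr stopped; rewrite -eval_ring_time /eval_urn map_draw_at.
have mnew k : measurable_fun setT (new k).
  by apply: measurable_funD; [exact: measurable_ring_time|exact: measurable_clock].
have [m1 m2] := @mlist_draw_at R a new (index j (L.1 ++ L.2)) F mnew
  (mlist_ring_time _ _) (mlist_ring_time _ _).
by apply: measurable_stopped => //; exact: measurable_ring_time.
Qed.

Section one_label.
Variables (n m : nat) (s : R) (L : seq label * seq label).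
Let l := L.1 ++ L.2.
Hypotheses (ul : uniq l) (ln : forall j, j \in l -> (j.1 <= n)%N).
Variables (j : label) (jl : j \in l).
Let L' := draw_at a (0, 0)%N (fun k => (n.+1, k)) (index j l) L.
Let Phi := after_ring m n s L j.
Hypothesis IH : forall s', (s' <= t)%R ->
  \int[Q]_c stopped a H t m n.+1 s' (urn_at s' c L') c = H n.+1 s' (size L'.1).

(** Once the clock of j is frozen at x and the clocks of the other balls are delayed
    by x, the urn after the draw is an urn with fresh clocks at time s + x. *)
Let Phi_delayed (x : R) (c : C) :
  Phi (set_clock (delay (rem j l) x c) j x) =
  if (s + x <= t)%R then stopped a H t m n.+1 (s + x)%R (urn_at (s + x)%R c L') c
  else H n t (size L.1).
Proof.
rewrite /Phi /after_ring; set c' := set_clock _ _ _.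
have -> : c' j = x by rewrite /c' /set_clock eqxx.
case: ifP => // _.
have c'E i k : (n < i)%N -> c' (i, k) = c (i, k).
  move=> ni; have ikl : (i, k) \notin l by apply/negP => /ln /=; rewrite leqNgt ni.
  rewrite /c' /set_clock /delay ifF; last by apply: contraNF ikl => /eqP ->.
  by rewrite ifF//; apply: contraNF ikl => /mem_rem.
rewrite (@stopped_ext _ _ _ _ a0 _ _ _ _ c' c); last by move=> i k ni; apply: c'E; exact: ltnW.
congr stopped; rewrite /urn_at /L' map_draw_at.
apply: draw_at_congr; rewrite ?size_map//=.
- by rewrite -map_cat size_map index_mem.
- move=> k kj; rewrite -!map_cat size_map => kl.
  rewrite !(nth_map (0, 0)%N)//.
  have nk : nth (0, 0)%N l k != j.
    by apply: contraNneq kj => <-; rewrite index_uniq.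
  rewrite /c' /set_clock -/l (negbTE nk) /delay mem_rem_uniq// !inE nk /= mem_nth//.
  by rewrite addrA.
- by move=> k; rewrite c'E.
Qed.

(** The clock of j is integrated out first; for a fixed value x of it, the event
    that j is drawn says that the other clocks exceed x, and [memoryless] applies.
    Its exponential factor for the other clocks, times the density of the clock of
    j, is the exponential with rate the number of balls. *)
Lemma integral_one_label :
  \int[Q]_c (if index (next_ring (urn_at s c L)) (map (fun j => s + c j)%R l) == index j l
    then Phi c else 0) =
  \int[leb]_(x in `[0%R, +oo[) ((if (s + x <= t)%R then H n.+1 (s + x)%R (size L'.1)
     else H n t (size L.1)) * (expR (- (x *+ size l)))%:E).
Proof.
pose b k := (index j l < index k l)%N.
pose ev (c : C) := all (fun k => c j < c k ?<= if b k)%R (rem j l).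
have mev : measurable_fun setT ev.
  rewrite /ev; elim: (rem j l) => [|k J IHJ] /=; first exact: measurable_cst.
  by apply: measurable_and => //; case: (b k) => /=;
    [apply: measurable_fun_ler|apply: measurable_fun_ltr]; exact: measurable_clock.
pose f (c : C) := if ev c then Phi c else 0.
have f0 c : 0 <= f c by rewrite /f; case: ifP => // _; exact: after_ring_ge0.
have mPhi : measurable_fun setT Phi := measurable_after_ring m n s L j.
have mf : measurable_fun setT f by exact: measurable_fun_ifT.
transitivity (\int[Q]_c f c).
  apply: eq_integral => c _; rewrite index_next_ring// /f /ev.
  by under eq_all do rewrite lteifD2l.
have mG : measurable_fun setT (fun x : R => \int[Q]_c f (set_clock c j x)).
  apply: (measurable_fun_fubini_tonelli_F
    (fun p : measurableTypeR R * C => f (set_clock p.2 j p.1))).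
    by apply: measurableT_comp => //; exact: measurable_set_clock.
  by move=> p; exact: f0.
rewrite (resample QE j mf f0) ge0_integral_expo//; last by move=> x; exact: integral_ge0.
apply: eq_integral => x; rewrite inE /= in_itv/= andbT => x0.
have lsz : size l = (size (rem j l)).+1.
  by rewrite size_rem// prednK//; case: (l) jl.
transitivity (\int[Q]_c (if all (fun k => x < c k ?<= if b k)%R (rem j l)
     then Phi (set_clock c j x) else 0)
   * (expR (- x))%:E).
  congr (_ * _); apply: eq_integral => c _; rewrite /f /ev; congr (if _ then _ else _).
  apply: eq_in_all => k; rewrite mem_rem_uniq// !inE => /andP[kj _].
  by rewrite /set_clock eqxx (negbTE kj).
have mPhix : measurable_fun setT (fun c : C => Phi (set_clock c j x)).
  by apply: measurableT_comp => //; exact: measurable_set_clock_at.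
rewrite (memoryless QE b x0 (rem_uniq j ul) mPhix); last first.
  by move=> c; exact: after_ring_ge0.
rewrite lsz mulrSr opprD expRD EFinM muleA; congr (_ * _).
rewrite muleC; congr (_ * _).
under eq_integral do rewrite Phi_delayed.
case: ifP => sx; first exact: IH.
by rewrite integral_cst//= probability_setT mule1.
Qed.

End one_label.

(** Induction on the number m of epochs allowed: the payoff is split according to
    the first ball drawn, [integral_one_label] and the induction hypothesis turn
    each term into an integral of H, and the sum over balls is the one step
    identity. *)
Theorem stopped_integral m n s (L : seq label * seq label) :
  (s <= t)%R -> uniq (L.1 ++ L.2) -> (forall j, j \in L.1 ++ L.2 -> (j.1 <= n)%N) ->
  size L.2 = (size L.1 + D)%N -> (a %| size L.1)%N ->
  \int[Q]_c stopped a H t m n s (urn_at s c L) c = H n s (size L.1).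
Proof.
elim: m n s L => [|m IH] n s L st; set l := L.1 ++ L.2 => ul ln szL aL.
  rewrite /=; under eq_integral do rewrite size_map.
  by rewrite integral_cst//= probability_setT mule1.
pose w := size L.1; pose v := ring_time s; pose Phi := after_ring m n s L.
pose idx c := index (next_ring (urn_at s c L)) (map (v^~ c) l).
have szl : size l = (w + (w + D))%N by rewrite /l size_cat szL.
pose L' j := draw_at a (0, 0)%N (fun k => (n.+1, k)) (index j l) L.
have szL' j : j \in l -> if j \in L.1 then
    [/\ size (L' j).1 = (w - a)%N, (a <= w)%N & size (L' j).2 = (w + D - a)%N]
  else size (L' j).1 = (w + a)%N /\ size (L' j).2 = (w + D + a)%N.
  move=> jl; have := @size_draw_at a _ (0, 0)%N (fun k => (n.+1, k)) (index j l) L.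
  rewrite index_mem -/l => /(_ jl) /=; rewrite szL -/w.
  have -> : (index j l < w)%N = (j \in L.1).
    rewrite /l index_cat; case: ifP => [jL1|_]; first by rewrite index_mem.
    by rewrite -/w ltnNge leq_addr.
  case: ifP => // jL1 [-> ->]; split => //.
  by apply: dvdn_leq => //; rewrite /w; case: (L.1) jL1.
transitivity (\int[Q]_c \sum_(j <- l) if idx c == index j l then Phi j c else 0).
  apply: eq_integral => c _ /=.
  set nr := next_ring _.
  have ncat : (urn_at s c L).1 ++ (urn_at s c L).2 = map (v^~ c) l.
    by rewrite /urn_at /= -map_cat.
  have nrl : nr \in map (v^~ c) l.
    by rewrite -ncat; apply: next_ring_mem; rewrite ncat size_map szl; lia.
  have lti : (idx c < size l)%N by rewrite -(size_map (v^~ c)) index_mem.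
  pose j0 := nth (0, 0)%N l (idx c).
  have j0l : j0 \in l by apply: mem_nth.
  have ij0 : index j0 l = idx c by rewrite index_uniq.
  rewrite (bigD1_seq j0)//= ij0 eqxx big1_seq ?adde0; last first.
    move=> j /andP[jj0 jl]; rewrite ifF//; apply: contraNF jj0 => /eqP ij.
    by rewrite /j0 ij nth_index.
  have vj0 : (s + c j0)%R = nr.
    by rewrite -(nth_index 0%R nrl) (nth_map (0, 0)%N)// /v /ring_time.
  rewrite /Phi /after_ring vj0 /urn_at size_map; case: ifP => // _.
  by rewrite drawE// ncat ij0.
have midx : measurable_fun setT (idx : C -> nat).
  rewrite (_ : idx = (fun c : C => index (next_ring (eval_urn (map_urn v L) c))
      [seq f c | f <- map v L.1 ++ map v L.2])); last first.
    by apply/funext => c; rewrite eval_ring_time -!map_cat -map_comp.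
  apply: measurable_index.
    by rewrite -map_cat; exact: mlist_ring_time.
  by apply: measurable_next_ring; exact: mlist_ring_time.
have mPhi j : measurable_fun setT (fun c : C => if idx c == index j l then Phi j c else 0).
  apply: measurable_fun_ifT => //; last exact: measurable_after_ring.
  exact: (measurableT_comp (f := fun k : nat => k == index j l)).
rewrite ge0_integral_sum//; last by move=> j c _; case: ifP => // _; exact: after_ring_ge0.
transitivity (\sum_(j <- l) \int[leb]_(x in `[0%R, +oo[)
   ((if (s + x <= t)%R then H n.+1 (s + x)%R (size (L' j).1) else H n t w) *
     (expR (- (x *+ size l)))%:E)).
  apply: eq_big_seq => j jl; apply: (integral_one_label (m := m)) => // s' s't.
  have jl' : (index j l < size l)%N by rewrite index_mem.
  have [uL' lL'] := @draw_at_fresh_labels a n (index j l) L jl' ul ln.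
  have := szL' _ jl; case: ifP => jL1; first move=> [s1 aw s2]; last move=> [s1 s2].
    apply: IH => //; rewrite -/(L' j) ?s1 ?s2; first by rewrite /w in aw *; lia.
    by rewrite dvdn_subr.
  apply: IH => //; rewrite -/(L' j) ?s1 ?s2; first by lia.
  by rewrite dvdn_addr.
rewrite -ge0_integral_sum//.
- rewrite -(H_harmonic n st aL); apply: eq_integral => x _.
  rewrite -ge0_sume_distrl; last by move=> j _; case: ifP.
  rewrite szl; congr (_ * _); rewrite /one_step_payoff; case: ifP => _.
    rewrite /l big_cat -/w -szL -!sume_const_seq//=; congr (_ + _).
      apply: eq_big_seq => j jL; have := szL' j; rewrite mem_cat jL => /(_ isT).
      by case=> ->.
    apply: eq_big_seq => j jL; have := szL' j; rewrite mem_cat jL orbT => /(_ isT).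
    rewrite ifF; first by case=> ->.
    move: ul; rewrite /l cat_uniq => /and3P[_ /hasPn + _] => /(_ _ jL) /negbTE -> //.
  by rewrite sume_const_seq// szl.
- move=> j; apply: emeasurable_funM; last first.
    apply/measurable_EFinP; apply: measurableT_comp => //; apply: measurableT_comp => //.
    exact: natmul_measurable.
  apply: measurable_funTS; apply: measurable_fun_ifT => //.
    by apply: measurable_fun_ler => //; exact: measurable_funD.
  by apply: (measurableT_comp (mH _ _)); exact: measurable_funD.
- by move=> j x _; rewrite mule_ge0 ?lee_fin ?expR_ge0//; case: ifP.
Qed.

End stopped_integral.

(** * Solutions of the backward Kolmogorov equation *)
Section exponential_killing.
Local Open Scope ereal_scope.
Context {R : realType}.
Local Notation leb := (@lebesgue_measure R).

Lemma integral_expR_tail (N tau k : R) : (0 < N)%R -> (0 <= k)%R ->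
  \int[leb]_(x in `[tau, +oo[) ((N * k)%:E * (expR (- (N * x)))%:E) =
    (k * expR (- (N * tau)))%:E.
Proof.
move=> N0 k0.
pose F (x : R) : R := (- (k * expR (- (N * x))))%R.
have dF (x : R) : is_derive x (1%R:R) F (N * k * expR (- (N * x)))%R.
  by rewrite /F; apply: is_derive_eq; rewrite /GRing.scale/=; ring.
have cF : continuous F.
  move=> x; apply/differentiable_continuous/derivable1_diffP.
  exact: (@ex_derive _ _ _ _ _ _ _ (dF x)).
under eq_integral do rewrite -EFinM.
rewrite (@ge0_continuous_FTC2y _ _ F _ 0).
- by rewrite /F EFinN oppeK add0e.
- by move=> x _; rewrite !mulr_ge0 ?expR_ge0// ltW.
- apply: continuous_subspaceT => x; apply: cvgM; first exact: cvg_cst.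
  apply: continuous_comp; last exact: continuous_expR.
  by apply: cvgN; apply: cvgM; [exact: cvg_cst|exact: cvg_id].
- rewrite /F -oppr0; apply: cvgN; rewrite -(mulr0 k); apply: cvgM; first exact: cvg_cst.
  apply: (@cvg_comp _ _ _ (fun x => N * x)%R (fun z => expR (- z)%R) _ (pinfty_nbhs R));
    last exact: cvgr_expR.
  exact: gt0_cvgMry.
- by move=> x _; exact: (@ex_derive _ _ _ _ _ _ _ (dF x)).
- by apply: cvg_at_right_filter; exact: cF.
- by move=> x _; rewrite derive1E; exact: (@derive_val _ _ _ _ _ _ _ (dF x)).
Qed.

(** On [s, t] the integrand, as a function of x, is the derivative of
    - exp (- N x) h (s + x), and beyond t it is that of - exp (- N x) h t. *)
Lemma integral_killed (h g : R -> R) (N s t : R) :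
  (0 < N)%R -> (s <= t)%R ->
  (forall x, (s <= x <= t)%R -> is_derive x (1%R:R) h (N * h x - g x)%R) ->
  (forall x, (s <= x <= t)%R -> {for x, continuous g}) ->
  measurable_fun setT g -> (0 <= h t)%R -> (forall x, (s <= x <= t)%R -> 0 <= g x)%R ->
  \int[leb]_(x in `[0%R, +oo[)
    ((if (s + x <= t)%R then (g (s + x))%:E else (N * h t)%:E) * (expR (- (N * x)))%:E)
  = (h s)%:E.
Proof.
move=> N0 st dh cg mg ht0 g0.
have tau0 : (0 <= t - s)%R by rewrite subr_ge0.
have mexp : measurable_fun setT (fun x : R => (expR (- (N * x)))%:E).
  apply/measurable_EFinP; apply: measurableT_comp => //; exact: measurableT_comp.
rewrite (@itv_bndbnd_setU _ _ _ (BRight (t - s)%R))//=.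
rewrite ge0_integral_setU//; last 3 first.
- apply: measurable_funTS; apply: emeasurable_funM => //.
  apply: measurable_fun_ifT => //.
    by apply: measurable_fun_ler => //; exact: measurable_funD.
  by apply/measurable_EFinP; apply: measurableT_comp => //; exact: measurable_funD.
- move=> x; rewrite -itv_bndbnd_setU//= ?bnd_simp// in_itv/= andbT => x0.
  rewrite mule_ge0 ?lee_fin ?expR_ge0//; case: ifP => sx; rewrite lee_fin.
    by apply: g0; rewrite sx lerDl x0.
  by rewrite mulr_ge0// ltW.
- apply/disj_setPS => x /=; rewrite !in_itv/= andbT => -[/andP[_ xt]].
  by rewrite ltNge xt.
have -> : \int[leb]_(x in `](t - s)%R, +oo[)
      ((if (s + x <= t)%R then (g (s + x))%:E else (N * h t)%:E) * (expR (- (N * x)))%:E)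
    = (h t * expR (- (N * (t - s))))%:E.
  rewrite -integral_expR_tail// -integral_itv_obnd_cbnd; last first.
    by apply: measurable_funTS; exact: emeasurable_funM.
  apply: eq_integral => x; rewrite inE/= in_itv/= andbT => xt.
  by rewrite ifF//; apply/negbTE; rewrite -ltNge -ltrBlDl.
have -> : \int[leb]_(x in `[0%R, (t - s)%R])
      ((if (s + x <= t)%R then (g (s + x))%:E else (N * h t)%:E) * (expR (- (N * x)))%:E)
    = (h s - h t * expR (- (N * (t - s))))%:E.
  have := tau0; rewrite le_eqVlt => /predU1P[tau00|tau_gt0].
    rewrite -tau00 set_itv1 integral_set1 (_ : s = t); last by lra.
    by rewrite mulr0 oppr0 expR0 mulr1 subrr.
  pose F (x : R) : R := (- (expR (- (N * x)) * h (s + x)))%R.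
  have dF (x : R) : (0 <= x <= t - s)%R ->
      is_derive x (1%R:R) F (g (s + x) * expR (- (N * x)))%R.
    move=> xI; have sxI : (s <= s + x <= t)%R by lra.
    have := dh _ sxI => dhx.
    have dhs : is_derive x (1%R:R) (fun y => h (s + y))%R (N * h (s + x) - g (s + x))%R.
      rewrite -[X in is_derive _ _ _ X]mulr1.
      apply: (@is_derive1_comp _ h (fun y => s + y)%R) => //.
      rewrite (_ : (fun y => s + y)%R = shift s); first exact: is_derive_shift.
      by apply/funext => y /=; rewrite addrC.
    by rewrite /F; apply: is_derive_eq; rewrite /GRing.scale/=; ring.
  have cF (x : R) : (0 <= x <= t - s)%R -> {for x, continuous F}.
    move=> xI; apply/differentiable_continuous/derivable1_diffP.
    exact: (@ex_derive _ _ _ _ _ _ _ (dF _ xI)).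
  transitivity (\int[leb]_(x in `[0%R, (t - s)%R]) ((g (s + x) * expR (- (N * x)))%:E)).
    apply: eq_integral => x; rewrite inE/= in_itv/= => /andP[x0 xt].
    by rewrite ifT//; lra.
  rewrite (@continuous_FTC2 _ _ F)//.
  - rewrite -EFinB /F; congr (_%:E); rewrite mulr0 oppr0 expR0 addr0 (_ : s + (t - s) = t)%R; ring.
  - apply: continuous_in_subspaceT => x; rewrite inE/= in_itv/= => xI.
    apply: cvgM.
      apply: (@continuous_comp _ _ _ (fun y => s + y)%R g); last by apply: cg; lra.
      by apply: cvgD; [exact: cvg_cst|exact: cvg_id].
    apply: continuous_comp; last exact: continuous_expR.
    by apply: cvgN; apply: cvgM; [exact: cvg_cst|exact: cvg_id].
  - split.
    + move=> x; rewrite in_itv/= => /andP[/ltW x0 /ltW xt].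
      by apply: (@ex_derive _ _ _ _ _ _ _ (dF x _)); rewrite x0.
    + by apply: cvg_at_right_filter; apply: cF; rewrite lexx.
    + by apply: cvg_at_left_filter; apply: cF; rewrite lexx andbT.
  - move=> x; rewrite in_itv/= => /andP[/ltW x0 /ltW xt].
    by rewrite derive1E; apply: (@derive_val _ _ _ _ _ _ _ (dF x _)); rewrite x0.
by rewrite -EFinD; congr (_%:E); ring.
Qed.

End exponential_killing.

Section payoffs.
Context {R : realType} (a D : nat) (t : R).
Hypotheses (a0 : (0 < a)%N) (D0 : (0 < D)%N).

(** Payoffs are only meaningful up to time t; the cut makes them nonnegative for all
    times. *)
Definition payoff_until (h : nat -> R -> nat -> R) (n : nat) (s : R) (w : nat) : \bar R :=
  if s <= t then (h n s w)%:E else 0%E.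

Lemma payoff_until_ge0 h n s w : (forall n s w, s <= t -> 0 <= h n s w) -> (0 <= payoff_until h n s w)%E.
Proof. by move=> h0; rewrite /payoff_until; case: ifP => // st; rewrite lee_fin h0. Qed.

Lemma measurable_payoff_until h n w : measurable_fun setT (fun s => h n s w) ->
  measurable_fun setT (fun s => payoff_until h n s w).
Proof.
move=> mh; apply: measurable_fun_ifT => //; last exact/measurable_EFinP.
exact: measurable_fun_ler.
Qed.

Definition kolmogorov_backward (h : nat -> R -> nat -> R) :=
  forall n s w, s <= t -> (a %| w)%N ->
  is_derive s (1 : R) (fun s => h n s w)
    ((w + (w + D))%:R * h n s w -
     (w%:R * h n.+1 s (w - a)%N + (w + D)%:R * h n.+1 s (w + a)%N)).

Lemma payoff_until_harmonic (h : nat -> R -> nat -> R) :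
  (forall n s w, s <= t -> 0 <= h n s w) ->
  (forall n w, measurable_fun setT (fun s => h n s w)) ->
  kolmogorov_backward h ->
  forall n s w, s <= t -> (a %| w)%N ->
  (\int[@lebesgue_measure R]_(x in `[0%R, +oo[)
    (one_step_payoff a D (payoff_until h) t n s w x *
      (expR (- (x *+ (w + (w + D)))))%:E) = payoff_until h n s w)%E.
Proof.
move=> h0 mh dh n s w st aw.
pose g (x : R) := w%:R * h n.+1 x (w - a)%N + (w + D)%:R * h n.+1 x (w + a)%N.
have ch m v x : x <= t -> (a %| v)%N -> {for x, continuous (fun s => h m s v)}.
  move=> xt av; apply/differentiable_continuous/derivable1_diffP.
  exact: (@ex_derive _ _ _ _ _ _ _ (dh m x v xt av)).
have aw1 : (a %| w - a)%N by apply: dvdn_sub.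
have aw2 : (a %| w + a)%N by apply: dvdn_add.
rewrite {2}/payoff_until st.
apply: etrans (integral_killed (h := fun s => h n s w) (g := g)
  (N := (w + (w + D))%:R) _ st _ _ _ _ _).
- apply: eq_integral => x _; rewrite /one_step_payoff /payoff_until lexx.
  congr (_ * _)%E; last by rewrite mulr_natl.
  by case: (s + x <= t); rewrite -?EFinM -?EFinD.
- by rewrite ltr0n; lia.
- by move=> x /andP[_ xt]; exact: dh.
- move=> x /andP[_ xt]; apply: cvgD; apply: cvgM; try exact: cvg_cst; exact: ch.
- by apply: measurable_funD; apply: measurable_funM.
- exact: h0.
- by move=> x /andP[_ xt]; rewrite addr_ge0// mulr_ge0// h0.
Qed.

(** The number of epochs so far, plus the expected number of those to come before t:
    the total rate is 2 w + D, and the expectation of w grows at rate a D. *)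
Definition epoch_payoff (n : nat) (s : R) (w : nat) : R :=
  n%:R + (t - s) * (2 * w%:R + D%:R) + a%:R * D%:R * (t - s) ^+ 2.

Lemma epoch_payoff_ge0 n s w : s <= t -> 0 <= epoch_payoff n s w.
Proof.
move=> st; have ts : 0 <= t - s by rewrite subr_ge0.
apply: addr_ge0; last by rewrite !mulr_ge0 ?exprn_ge0.
by apply: addr_ge0 => //; apply: mulr_ge0 => //; rewrite addr_ge0// mulr_ge0.
Qed.

Lemma measurable_epoch_payoff n w : measurable_fun setT (fun s => epoch_payoff n s w).
Proof.
have ms : measurable_fun setT (fun s : R => t - s) by apply: measurable_funB.
apply: measurable_funD; last by apply: measurable_funM => //; exact: measurable_funX.
by apply: measurable_funD => //; exact: measurable_funM.
Qed.

Lemma epoch_payoff_kolmogorov : kolmogorov_backward epoch_payoff.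
Proof.
move=> n s w st aw; rewrite /epoch_payoff; apply: is_derive_eq; rewrite /GRing.scale/=.
(* The truncated subtraction is harmless: w is either 0 or at least a. *)
have : w%:R * (w - a)%:R = w%:R * (w%:R - a%:R) :> R.
  have [->|w0] := posnP w; first by rewrite !mul0r.
  by rewrite natrB// dvdn_leq.
rewrite -(natr1 n) !natrD => E.
have -> : forall A B C : R, w%:R * (A + B * (2 * (w - a)%:R + D%:R) + C) =
   w%:R * (A + B * D%:R + C) + B * 2 * (w%:R * (w - a)%:R) by move=> A B C; ring.
by rewrite E; ring.
Qed.

Variable q : R.
Hypotheses (q0 : 0 < q) (q1 : q < 1).

(** The expectation of (1 - q) ^ (W(t) / a) for the chain started from w at time s,
    namely ((u - q) / u) ^ (w / a) * u ^ (- D / a). *)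
Definition laplace_payoff (n : nat) (s : R) (w : nat) : R :=
  let u := 1 + a%:R * q * (t - s) in
  expR (w%:R / a%:R * ln (u - q) - (w + D)%:R / a%:R * ln u).

Lemma laplace_payoff_ge0 n s w : 0 <= laplace_payoff n s w.
Proof. exact: expR_ge0. Qed.

Lemma measurable_laplace_payoff n w : measurable_fun setT (fun s => laplace_payoff n s w).
Proof.
have ms : measurable_fun setT (fun s : R => 1 + a%:R * q * (t - s)).
  by apply: measurable_funD => //; apply: measurable_funM => //; exact: measurable_funB.
apply: measurableT_comp => //; apply: measurable_funB; apply: measurable_funM => //;
  apply: measurableT_comp => //.
exact: measurable_funB.
Qed.

(** Changing w by a multiplies the payoff by (u - q) / u or its inverse, and its
    derivative in u is (w / (u - q) - (w + D) / u) / a times it: both sides of the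
    equation are rational multiples of the payoff. *)
Lemma laplace_payoff_kolmogorov : kolmogorov_backward laplace_payoff.
Proof.
move=> n s w st aw.
pose u (s : R) := 1 + a%:R * q * (t - s).
have an0 : (a%:R : R) != 0 by rewrite pnatr_eq0 -lt0n.
have u1 : 1 <= u s by rewrite /u lerDl !mulr_ge0// ?subr_ge0// ltW.
have us : 0 < u s by exact: lt_le_trans u1.
have vs : 0 < u s - q by rewrite subr_gt0; exact: lt_le_trans q1 u1.
have du : is_derive s (1:R) u (- (a%:R * q)).
  by rewrite /u; apply: is_derive_eq; rewrite /GRing.scale/=; ring.
have dlu : is_derive s (1:R) (fun s => ln (u s)) ((u s)^-1 * - (a%:R * q)).
  by apply: (@is_derive1_comp _ (@ln R) u) => //; exact: is_derive1_ln.
have dv : is_derive s (1:R) (fun s => u s - q) (- (a%:R * q)).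
  by apply: is_derive_eq; rewrite subr0.
have dlv : is_derive s (1:R) (fun s => ln (u s - q)) ((u s - q)^-1 * - (a%:R * q)).
  by apply: (@is_derive1_comp _ (@ln R) (fun s => u s - q)) => //; exact: is_derive1_ln.
have uv : u s / (u s - q) = expR (ln (u s) - ln (u s - q)).
  by rewrite expRD expRN !lnK// posrE.
have vu : (u s - q) / u s = expR (ln (u s - q) - ln (u s)).
  by rewrite expRD expRN !lnK// posrE.
have E1 : w%:R * laplace_payoff n.+1 s (w - a)%N =
    w%:R * laplace_payoff n s w * (u s / (u s - q)).
  have [->|w0] := posnP w; first by rewrite !mul0r.
  have aw' : (a <= w)%N by rewrite dvdn_leq.
  rewrite -mulrA; congr (_ * _); rewrite uv /laplace_payoff -/(u s) -expRD; congr expR.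
  by rewrite addnBAC// !natrB// ?(leq_trans aw') ?leq_addr//; field.
have E2 : laplace_payoff n.+1 s (w + a)%N = laplace_payoff n s w * ((u s - q) / u s).
  rewrite vu /laplace_payoff -/(u s) -expRD; congr expR.
  by rewrite addnAC !natrD; field.
rewrite E1 E2.
have -> : (fun s => laplace_payoff n s w) =
  expR \o (fun s => w%:R / a%:R * ln (u s - q) - (w + D)%:R / a%:R * ln (u s)) by [].
have dexp : is_derive s (1:R)
    (fun s => w%:R / a%:R * ln (u s - q) - (w + D)%:R / a%:R * ln (u s))
    (w%:R / a%:R * ((u s - q)^-1 * - (a%:R * q)) -
     (w + D)%:R / a%:R * ((u s)^-1 * - (a%:R * q))).
  by apply: is_derive_eq.
apply: is_derive_eq; rewrite -/(laplace_payoff n s w).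
rewrite !natrD; move: (laplace_payoff n s w) => y.
by field; rewrite an0 !gt_eqF.
Qed.

End payoffs.

(** * Laplace transform of the number of white balls *)
Section clocks_of_process.
Context d (T : measurableType d) (R : realType) (P : probability T R).
Context {I : choiceType}.
Variable X : I -> {RV P >-> R}.

Definition joint_clock (x : T) : clocks I R := fun i => X i x.

Lemma measurable_joint_clock : measurable_fun setT joint_clock.
Proof. by apply: measurable_clocks => i; exact: measurable_funP. Qed.

HB.instance Definition _ :=
  isMeasurableFun.Build _ _ T (clocks I R) joint_clock measurable_joint_clock.

Definition clock_law : probability (clocks I R) R := distribution P joint_clock.

Lemma clock_lawE (nu : probability (measurableTypeR R) R) :
  mutually_independent X ->
  (forall i (A : set R), measurable A -> distribution P (X i) A = nu A) ->
  forall (s : seq I) (A : I -> set R), uniq s -> (forall i, measurable (A i)) ->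
  clock_law (cylinder s A) = (\prod_(i <- s) nu (A i))%E.
Proof.
move=> ind law s A us mA.
have -> : clock_law (cylinder s A) = P (\big[setI/setT]_(i <- s) (X i @^-1` A i)).
  congr (P _); rewrite -(bigcap_seq s (fun i => X i @^-1` A i)).
  by apply/seteqP; split => x /= H i; [move=> /= ii|move=> ii]; exact: (H i).
rewrite ind//; apply: eq_bigr => i _; exact: law.
Qed.

End clocks_of_process.

Lemma le_inv_nat_le0 {R : realType} (r C : R) : (forall m, (0 < m)%N -> r <= C / m%:R) -> r <= 0.
Proof.
move=> rC; rewrite leNgt; apply/negP => r0.
have := rC (Num.truncn (C / r)).+1 isT; apply/negP; rewrite -ltNge.
by rewrite ltr_pdivrMr// mulrC -ltr_pdivrMr// truncnS_gt.
Qed.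

Section laplace.
Context d (T : measurableType d) (R : realType) (P : probability T R).
Variables (a D w0 b0 : nat).
Hypotheses (a0 : (0 < a)%N) (D0 : (0 < D)%N) (b0E : b0 = (w0 + D)%N) (aw0 : (a %| w0)%N).
Local Notation M := (constant_differentials_mx a).
Local Notation label := (nat * nat)%type.
Local Notation C := (clocks label R).

Definition initial_labels : seq label * seq label :=
  (mkseq (fun k => (0, k)%N) w0, mkseq (fun k => (0, w0 + k)%N) b0).

Lemma initial_urnE (c : C) : initial_urn w0 b0 c = urn_at 0 c initial_labels.
Proof.
rewrite /initial_urn /urn_at /map_urn /= /mkseq -!map_comp.
by congr pair; apply: eq_map => k /=; rewrite add0r.
Qed.

Lemma initial_labels_uniq : uniq (initial_labels.1 ++ initial_labels.2).
Proof.
rewrite (_ : _ ++ _ = mkseq (fun k => (0, k)%N) (w0 + b0)).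
  by rewrite mkseq_uniq// => ? ? [].
by rewrite /mkseq iotaD map_cat add0n; congr cat; rewrite -[X in iota X]addn0 iotaDl -map_comp.
Qed.

Lemma initial_labels_epoch j : j \in initial_labels.1 ++ initial_labels.2 -> (j.1 <= 0)%N.
Proof. by rewrite mem_cat => /orP[] /mapP[k _ ->]. Qed.

Variable X : label -> {RV P >-> R}.
Hypothesis expX : exponential_clocks X.
Variable t : R.
Hypothesis t0 : 0 <= t.

Definition stopped_process (H : nat -> R -> nat -> \bar R) (m : nat) (x : T) : \bar R :=
  let c := joint_clock X x in stopped a H t m 0 0 (initial_urn w0 b0 c) c.

Lemma measurable_stopped_init (H : nat -> R -> nat -> \bar R) m :
  (forall n w, measurable_fun setT (fun s => H n s w)) ->
  measurable_fun setT (fun c : C => stopped a H t m 0 0 (initial_urn w0 b0 c) c).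
Proof.
move=> mH.
rewrite (_ : (fun c => _) = fun c : C => stopped a H t m 0 0
  (eval_urn (map_urn (ring_time 0) initial_labels) c) c); last first.
  by apply/funext => c; rewrite eval_ring_time initial_urnE.
apply: (@measurable_stopped _ _ _ _ a0 mH m 0%N (fun=> 0)) => //; exact: mlist_ring_time.
Qed.

Lemma measurable_stopped_process H m :
  (forall n w, measurable_fun setT (fun s => H n s w)) ->
  measurable_fun setT (stopped_process H m).
Proof.
move=> mH; apply: (measurableT_comp (measurable_stopped_init m mH)).
exact: measurable_joint_clock.
Qed.

Lemma integral_stopped_process (h : nat -> R -> nat -> R) m :
  (forall n s w, s <= t -> 0 <= h n s w) ->
  (forall n w, measurable_fun setT (fun s => h n s w)) ->
  kolmogorov_backward a D t h ->
  (\int[P]_x stopped_process (payoff_until t h) m x = (h 0%N 0 w0)%:E)%E.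
Proof.
move=> h0 mh dh.
pose H := payoff_until t h.
have H0 n s w : (0 <= H n s w)%E by exact: payoff_until_ge0.
have mH n w : measurable_fun setT (fun s => H n s w) by exact: measurable_payoff_until.
have [ind law] := expX.
have QE := @clock_lawE _ _ _ _ _ X (@expo R) ind law.
have harm := payoff_until_harmonic a0 D0 h0 mh dh.
have <- : H 0%N 0 w0 = (h 0%N 0 w0)%:E by rewrite /H /payoff_until t0.
have := @stopped_integral R a D H t a0 D0 mH H0 (clock_law X) QE harm m 0%N 0 initial_labels t0
  initial_labels_uniq initial_labels_epoch.
rewrite /= !size_mkseq => /(_ b0E aw0) <-.
rewrite (@ge0_integral_distribution _ _ _ _ _ P (joint_clock X)).
- by apply: eq_integral => x _; rewrite /stopped_process initial_urnE.
- rewrite (_ : (fun y => _) = fun c : C => stopped a H t m 0 0 (initial_urn w0 b0 c) c).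
    exact: measurable_stopped_init.
  by apply/funext => c; rewrite initial_urnE.
- by move=> c; exact: stopped_ge0.
Qed.

Lemma stopped_processP (x : T) (m : nat) :
  let c := joint_clock X x in
  (exists s w, s <= t /\ forall H, stopped_process H m x = H m s w) \/
  exists2 j, epoch M w0 b0 c j <= t < epoch M w0 b0 c j.+1 &
    (j < m)%N /\ forall H, stopped_process H m x = H j t (size (urn_after M w0 b0 c j).1).
Proof.
move=> c; have [[et E]|[j ej E]] := @stopped_urn_after R a t m 0 w0 b0 c t0.
  by left; exists (epoch M w0 b0 c m), (size (urn_after M w0 b0 c m).1).
by right; exists j.
Qed.

(** As a payoff after at most m epochs, the indicator of having reached m epochs
    by time t. *)
Definition reaches (m n : nat) (s : R) (w : nat) : \bar R := (n == m)%:R%:E.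

Lemma measurable_reaches m : measurable_fun setT (stopped_process (reaches m) m).
Proof. by apply: measurable_stopped_process => n w; exact: measurable_cst. Qed.

Lemma stopped_process_ge0 H m x : (forall n s w, 0 <= H n s w)%E ->
  (0 <= stopped_process H m x)%E.
Proof. by move=> H0; exact: stopped_ge0. Qed.

Let epoch_bound : R := epoch_payoff a D t 0 0 w0.

Let measurable_process h m : (forall n w, measurable_fun setT (fun s => h n s w)) ->
  measurable_fun setT (stopped_process (payoff_until t h) m).
Proof. by move=> mh; apply: measurable_stopped_process => n w; exact: measurable_payoff_until. Qed.

Let until_process_ge0 h m x : (forall n s w, s <= t -> 0 <= h n s w) ->
  (0 <= stopped_process (payoff_until t h) m x)%E.
Proof. by move=> h0; apply: stopped_process_ge0 => n s w; exact: payoff_until_ge0. Qed.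

(** If m epochs occur before t, [epoch_payoff] is at least m when it is collected. *)
Lemma integral_reaches_le m : (0 < m)%N ->
  (\int[P]_x stopped_process (reaches m) m x <= (epoch_bound / m%:R)%:E)%E.
Proof.
move=> m0; have mR : 0 < m%:R :> R by rewrite ltr0n.
rewrite EFinM lee_pdivlMr// muleC -ge0_integralZl//; last 2 first.
- exact: measurable_reaches.
- by move=> x _; apply: stopped_process_ge0 => *; rewrite lee_fin.
have mep := @measurable_epoch_payoff R a D t.
have ep0 := @epoch_payoff_ge0 R a D t.
rewrite -(integral_stopped_process m ep0 mep (@epoch_payoff_kolmogorov R a D t)).
apply: ge0_le_integral => //.
- by move=> x _; rewrite mule_ge0//; apply: stopped_process_ge0 => *; rewrite lee_fin.
- by apply: emeasurable_funM => //; exact: measurable_reaches.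
- exact: measurable_process.
- move=> x _; have [[s [w [st E]]]|[j _ [jm E]]] := stopped_processP x m.
    rewrite !E /reaches eqxx mule1 /payoff_until st lee_fin /epoch_payoff.
    have ts : 0 <= t - s by rewrite subr_ge0.
    rewrite -addrA lerDl addr_ge0//; first by rewrite mulr_ge0// addr_ge0// mulr_ge0.
    by rewrite !mulr_ge0 ?exprn_ge0.
  rewrite [X in (_ * X <= _)%E]E /reaches (ltn_eqF jm) mule0.
  exact: until_process_ge0.
Qed.

Variables (W B : R -> {RV P >-> R}) (theta : R).
Hypothesis theta0 : 0 < theta.
Hypothesis WE : {ae P, forall x : T, let clock i := X i x in
    forall (n : nat) (t : R),
      epoch M w0 b0 clock n <= t < epoch M w0 b0 clock n.+1 ->
      W t x = (size (urn_after M w0 b0 clock n).1)%:R /\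
      B t x = (size (urn_after M w0 b0 clock n).2)%:R}.

Let q : R := 1 - expR (- (a%:R * theta)).

Let q0 : 0 < q.
Proof. by rewrite subr_gt0 -[ltRHS]expR0 ltr_expR oppr_lt0 mulr_gt0 ?ltr0n. Qed.

Let q1 : q < 1.
Proof. by rewrite ltrBlDr ltrDl expR_gt0. Qed.

Let Phi m := stopped_process (payoff_until t (laplace_payoff a D t q)) m.
Let beta m := stopped_process (reaches m) m.

Lemma laplace_payoff_le1 n s w : s <= t -> laplace_payoff a D t q n s w <= 1.
Proof.
move=> st; rewrite -[leRHS]expR0 /laplace_payoff ler_expR subr_le0.
set u := 1 + _.
have ts : 0 <= t - s by rewrite subr_ge0.
have q0' := ltW q0.
have u1 : 1 <= u by rewrite lerDl !mulr_ge0.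
have uq : 0 < u - q by rewrite subr_gt0 (lt_le_trans q1).
apply: (@le_trans _ _ (w%:R / a%:R * ln u)).
  have uqu : u - q <= u by rewrite lerBlDr lerDl.
  by apply: ler_wpM2l; rewrite ?divr_ge0// ler_ln// posrE// (lt_le_trans uq).
apply: ler_wpM2r; first exact: ln_ge0.
by apply: ler_wpM2r; rewrite ?invr_ge0// ler_nat leq_addr.
Qed.

Lemma laplace_payoff_stop n w : laplace_payoff a D t q n t w = expR (- (theta * w%:R)).
Proof.
rewrite /laplace_payoff subrr mulr0 addr0 ln1 mulr0 subr0 /q.
have -> : 1 - (1 - expR (- (a%:R * theta))) = expR (- (a%:R * theta)) :> R by ring.
by rewrite expRK; congr expR; field; rewrite pnatr_eq0 -lt0n.
Qed.

(** Outside of explosion, the stopped payoff Phi m is exp (- theta W(t)) unless m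
    epochs occur before t; in that case both lie in [0, 1], whence the error beta m,
    the indicator of that event. *)
Lemma ae_stopped_process : {ae P, forall x,
  (forall m, beta m x = 1) \/ (0 <= W t x)%R /\ forall m,
    (expR (- (theta * W t x)))%:E <= Phi m x + beta m x /\
    Phi m x <= (expR (- (theta * W t x)))%:E + beta m x}%E.
Proof.
move: WE; apply: filterS => x Wx.
have [|/existsNP[m0 bm0]] := pselect (forall m, beta m x = 1%E); first by left.
have beta_ge0 m : (0 <= beta m x)%E by apply: stopped_process_ge0 => *; rewrite lee_fin.
right; have W0 : 0 <= W t x.
  have [[s [w [st E]]]|[j ej _]] := stopped_processP x m0.
    by exfalso; apply: bm0; rewrite /beta E /reaches eqxx.
  by have [-> _] := Wx j t ej.
split => // m.
have Y1 : ((expR (- (theta * W t x)))%:E <= 1)%E.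
  by rewrite lee_fin -expR0 ler_expR oppr_le0 mulr_ge0// ltW.
have [[s [w [st E]]]|[j ej [jm E]]] := stopped_processP x m.
  rewrite /beta /Phi !E /reaches eqxx /payoff_until st; split.
    by apply: (le_trans Y1); rewrite leeDr// lee_fin laplace_payoff_ge0.
  apply: (@le_trans _ _ 1%E); first by rewrite lee_fin laplace_payoff_le1.
  by rewrite leeDr// lee_fin expR_ge0.
have [Wj _] := Wx j t ej.
by rewrite /Phi E /payoff_until lexx laplace_payoff_stop -Wj !leeDl.
Qed.

Let integral_Phi m : (\int[P]_x Phi m x = (laplace_payoff a D t q 0 0 w0)%:E)%E.
Proof.
apply: integral_stopped_process.
- by move=> n s w _; exact: laplace_payoff_ge0.
- by move=> n w; exact: measurable_laplace_payoff.
- exact: laplace_payoff_kolmogorov.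
Qed.

Let beta_ge0 m x : (0 <= beta m x)%E.
Proof. by apply: stopped_process_ge0 => *; rewrite lee_fin. Qed.

Lemma ae_not_exhausted : {ae P, forall x, ~ forall m, beta m x = 1%E}.
Proof.
pose N := \bigcap_m (beta m @^-1` [set 1%E]).
have mb m : measurable (beta m @^-1` [set 1%E]).
  by rewrite -[X in measurable X]setTI; apply: (measurable_reaches m).
have mN : measurable N by exact: bigcapT_measurable.
exists N; split => //; last by move=> x /= /contrapT H m _; exact: H.
have PN m : (0 < m)%N -> (P N <= (epoch_bound / m%:R)%:E)%E.
  move=> m0; apply: le_trans (integral_reaches_le m0).
  rewrite -[N]setIT -integral_indic//; apply: ge0_le_integral => //.
  - exact/measurable_EFinP/measurable_indic.
  - exact: measurable_reaches.
  - move=> x _; rewrite indicE; have [xN|_] := boolP (x \in N).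
      by have /(_ m I) /= := set_mem xN; rewrite /beta => ->.
    exact: beta_ge0.
apply/eqP; rewrite eq_le measure_ge0 andbT.
have PNf : P N \is a fin_num by exact: fin_num_measure.
rewrite -(fineK PNf) lee_fin; apply: (le_inv_nat_le0 (C := epoch_bound)) => m m0.
by rewrite -lee_fin fineK// PN.
Qed.

Lemma ae_ge0_process : {ae P, forall x, 0 <= W t x}.
Proof.
move: ae_stopped_process ae_not_exhausted; apply: filterS2 => x [//|[W0 _] _].
exact: W0.
Qed.

Lemma laplace_process :
  (\int[P]_x (expR (- (theta * W t x)))%:E = (laplace_payoff a D t q 0 0 w0)%:E)%E.
Proof.
set L := laplace_payoff _ _ _ _ _ _ _.
pose Y x := (expR (- (theta * W t x)))%:E.
have Y0 x : (0 <= Y x)%E by rewrite lee_fin expR_ge0.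
have mY : measurable_fun setT Y.
  apply/measurable_EFinP; apply: measurableT_comp => //; apply: measurableT_comp => //.
  exact: measurable_funM.
have mPhi m : measurable_fun setT (Phi m).
  by apply: measurable_process => n w; exact: measurable_laplace_payoff.
have Phi0 m x : (0 <= Phi m x)%E.
  by apply: until_process_ge0 => *; exact: laplace_payoff_ge0.
have mbeta m : measurable_fun setT (beta m) := measurable_reaches m.
have ae_bound : {ae P, forall x, forall m,
    Y x <= Phi m x + beta m x /\ Phi m x <= Y x + beta m x}%E.
  by move: ae_stopped_process ae_not_exhausted; apply: filterS2 => x [//|[_ YP] _].
have le1 m : (\int[P]_x Y x <= L%:E + \int[P]_x beta m x)%E.
  rewrite -(integral_Phi m) -ge0_integralD//.
  apply: ae_ge0_le_integral => //.
  - by move=> x _; rewrite adde_ge0.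
  - exact: emeasurable_funD.
  - by move: ae_bound; apply: filterS => x /(_ m)[].
have le2 m : (L%:E <= \int[P]_x Y x + \int[P]_x beta m x)%E.
  rewrite -(integral_Phi m) -ge0_integralD//.
  apply: ae_ge0_le_integral => //.
  - by move=> x _; rewrite adde_ge0.
  - exact: emeasurable_funD.
  - by move: ae_bound; apply: filterS => x /(_ m)[].
have Yfin : (\int[P]_x Y x)%E \is a fin_num.
  rewrite ge0_fin_numE ?integral_ge0//; apply: le_lt_trans (le1 1%N) _.
  by rewrite lte_add_pinfty ?ltry// (le_lt_trans (integral_reaches_le _))// ltry.
rewrite -/(Y _) -(fineK Yfin); congr (_%:E).
have bnd m : (0 < m)%N -> (\int[P]_x beta m x <= (epoch_bound / m%:R)%:E)%E.
  by exact: integral_reaches_le.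
apply/eqP; rewrite eq_le -subr_le0 -(subr_le0 _ L); apply/andP; split.
  apply: (le_inv_nat_le0 (C := epoch_bound)) => m m0.
  by rewrite lerBlDl -lee_fin fineK// EFinD (le_trans (le1 m))// leeD2l// bnd.
apply: (le_inv_nat_le0 (C := epoch_bound)) => m m0.
by rewrite lerBlDl -lee_fin EFinD fineK// (le_trans (le2 m))// leeD2l// bnd.
Qed.

End laplace.

(** * The gamma law *)
Section gamma_function.
Context {R : realType}.
Local Notation leb := (@lebesgue_measure R).

Definition gamma_integrand (alpha x : R) : R := x `^ (alpha - 1) * expR (- x).

Lemma gamma_integrand_ge0 alpha x : 0 <= gamma_integrand alpha x.
Proof. by rewrite mulr_ge0 ?powR_ge0 ?expR_ge0. Qed.

Lemma measurable_gamma_integrand alpha : measurable_fun setT (gamma_integrand alpha).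
Proof.
apply: measurable_funM; first exact: measurable_powR.
exact: measurableT_comp.
Qed.

(** The integrand may be unbounded at 0: the fundamental theorem of calculus is
    applied on [1 / (n + 2), 1], and monotone convergence concludes. *)
Lemma integral_powR_01 (alpha : R) : 0 < alpha ->
  (\int[leb]_(x in `]0%R, 1%R]) (x `^ (alpha - 1))%:E <= (alpha^-1)%:E)%E.
Proof.
move=> al0.
pose F n := (`[n.+2%:R^-1, 1]%classic : set R).
have FU : \bigcup_n F n = `]0, 1]%classic.
  apply/seteqP; split => x.
    move=> [n _]; rewrite /F /= !in_itv /= => /andP[nx ->]; rewrite andbT.
    by apply: lt_le_trans nx; rewrite invr_gt0.
  rewrite /= in_itv/= => /andP[x0 x1]; exists (Num.truncn x^-1) => //.
  rewrite /F /= in_itv/= x1 andbT -[leRHS]invrK lef_pV2 ?posrE// ?invr_gt0//.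
  by rewrite ltW// (lt_trans (truncnS_gt _))// ltr_nat.
have mp (D : set R) : measurable_fun D (fun x : R => (x `^ (alpha - 1))%:E).
  by apply: measurable_funTS; apply/measurable_EFinP; exact: measurable_powR.
have cv : (\int[leb]_(x in F i) (x `^ (alpha - 1))%:E @[i --> \oo] -->
    \int[leb]_(x in \bigcup_i F i) (x `^ (alpha - 1))%:E)%E.
  apply: ge0_nondecreasing_set_cvg_integral => //.
  - move=> m n mn; apply/subsetPset => x; rewrite /F /= !in_itv/= => /andP[mx ->].
    by rewrite andbT (le_trans _ mx)// lef_pV2 ?posrE// ler_nat.
  - by move=> i; exact: measurable_itv.
  - by move=> i; exact: mp.
  - by move=> i x _; rewrite lee_fin powR_ge0.
rewrite -FU -(cvg_lim _ cv)//; apply: lime_le; first exact: (cvgP _ cv).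
apply: nearW => n; rewrite /F.
have n0 : 0 < n.+2%:R^-1 :> R by rewrite invr_gt0.
have n1 : n.+2%:R^-1 < 1 :> R by rewrite invf_lt1// ltr1n.
pose G (x : R) : R := alpha^-1 * x `^ alpha.
have dG (x : R) : 0 < x -> is_derive x (1 : R) G (x `^ (alpha - 1)).
  move=> x0; have := is_derive1_powR alpha x0 => dp.
  by rewrite /G; apply: is_derive_eq; rewrite /GRing.scale/= mulKf// gt_eqF.
have cp (p x : R) : 0 < x -> {for x, continuous (fun y : R => y `^ p)}.
  move=> x0; apply/differentiable_continuous/derivable1_diffP.
  exact: (@ex_derive _ _ _ _ _ _ _ (is_derive1_powR p x0)).
have cG (x : R) : 0 < x -> {for x, continuous G}.
  by move=> x0; apply: cvgM; [exact: cvg_cst|exact: cp].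
rewrite (@continuous_FTC2 _ _ G)//.
- rewrite -EFinB lee_fin /G powR1 mulr1 lerBlDr lerDl.
  by rewrite mulr_ge0 ?powR_ge0// invr_ge0 ltW.
- apply: continuous_in_subspaceT => x; rewrite inE/= in_itv/= => /andP[nx _].
  by apply: cp; exact: lt_le_trans nx.
- split.
  + move=> x; rewrite in_itv/= => /andP[nx _].
    by apply: (@ex_derive _ _ _ _ _ _ _ (dG x _)); exact: lt_trans nx.
  + by apply: cvg_at_right_filter; exact: cG.
  + by apply: cvg_at_left_filter; exact: cG.
- move=> x; rewrite in_itv/= => /andP[nx _].
  by rewrite derive1E; apply: (@derive_val _ _ _ _ _ _ _ (dG x _)); exact: lt_trans nx.
Qed.

(** From ln y <= y - 1 at y = x / (2 p). *)
Lemma powR_le_expR (p x : R) : 0 < p -> 0 < x -> x `^ p <= (2 * p) `^ p * expR (x / 2).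
Proof.
move=> p0 x0; have pp : 0 < 2 * p by rewrite mulr_gt0.
rewrite {1 2}/powR !gt_eqF// -expRD ler_expR.
have lnx : ln x = ln (x / (2 * p)) + ln (2 * p).
  by rewrite -lnM ?posrE ?divr_gt0// divfK// gt_eqF.
have : ln (x / (2 * p)) <= x / (2 * p) - 1.
  by rewrite -[X in ln X](subrKC 1) le_ln1Dx// ltrBrDl subrr divr_gt0.
rewrite -(ler_pM2l p0).
have -> : p * (x / (2 * p) - 1) = x / 2 - p by field; rewrite gt_eqF.
by rewrite lnx mulrDr; lra.
Qed.

Lemma integral_gamma_1y (alpha : R) : 0 < alpha ->
  (\int[leb]_(x in `[1%R, +oo[) (gamma_integrand alpha x)%:E < +oo)%E.
Proof.
move=> al0; pose C := (2 * alpha) `^ alpha.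
have epoch_bound : 0 <= C by exact: powR_ge0.
apply: (@le_lt_trans _ _ (\int[leb]_(x in `[1%R, +oo[) (C * expR (- (2^-1 * x)))%:E)%E).
  apply: ge0_le_integral => //.
  - by move=> x _; rewrite lee_fin gamma_integrand_ge0.
  - by apply: measurable_funTS; apply/measurable_EFinP; exact: measurable_gamma_integrand.
  - apply: measurable_funTS; apply/measurable_EFinP; apply: measurable_funM => //.
    by apply: measurableT_comp => //; exact: measurableT_comp.
  move=> x; rewrite /= in_itv/= andbT => x1; rewrite lee_fin /gamma_integrand.
  have x0 : 0 < x by exact: lt_le_trans x1.
  apply: (@le_trans _ _ (C * expR (x / 2) * expR (- x))).
    rewrite ler_wpM2r ?expR_ge0// (le_trans _ (powR_le_expR _ _))//.
    by rewrite ler_powR// gerBl.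
  by rewrite -mulrA -expRD ler_wpM2l// ler_expR; lra.
have CE : C = 2^-1 * (2 * C) by field.
under eq_integral => x _ do rewrite EFinM CE.
by rewrite integral_expR_tail ?ltry// mulr_ge0.
Qed.

Lemma integral_gamma_lty (alpha : R) : 0 < alpha ->
  (\int[leb]_(x in `]0%R, +oo[) (gamma_integrand alpha x)%:E < +oo)%E.
Proof.
move=> al0.
have mg (D : set R) : measurable_fun D (fun x : R => (gamma_integrand alpha x)%:E).
  by apply: measurable_funTS; apply/measurable_EFinP; exact: measurable_gamma_integrand.
rewrite (@itv_bndbnd_setU _ _ _ (BRight 1))//=; last by rewrite bnd_simp.
rewrite ge0_integral_setU//; last 3 first.
- exact: mg.
- by move=> x _; rewrite lee_fin gamma_integrand_ge0.
- apply/disj_setPS => x /=; rewrite !in_itv/= andbT => -[/andP[_ x1]].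
  by rewrite ltNge x1.
rewrite [X in (_ + X)%E]integral_itv_obnd_cbnd//.
apply: lte_add_pinfty; last exact: integral_gamma_1y.
apply: le_lt_trans (ltry alpha^-1); apply: le_trans (integral_powR_01 al0).
apply: ge0_le_integral => //.
- by move=> x _; rewrite lee_fin gamma_integrand_ge0.
- by apply: measurable_funTS; apply/measurable_EFinP; exact: measurable_gamma_integrand.
- by apply: measurable_funTS; apply/measurable_EFinP; exact: measurable_powR.
- move=> x; rewrite /= in_itv/= => /andP[x0 _]; rewrite lee_fin.
  by rewrite ler_piMr ?powR_ge0// -expR0 ler_expR oppr_le0 ltW.
Qed.

Lemma integral_gamma_gt0 (alpha : R) : 0 < alpha ->
  (0 < \int[leb]_(x in `]0%R, +oo[) (gamma_integrand alpha x)%:E)%E.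
Proof.
move=> al0.
have mg (D : set R) : measurable_fun D (fun x : R => (gamma_integrand alpha x)%:E).
  by apply: measurable_funTS; apply/measurable_EFinP; exact: measurable_gamma_integrand.
apply: (@lt_le_trans _ _ (\int[leb]_(x in `[1%R, 2%R]) (2^-1 * expR (- 2))%:E)%E).
  rewrite integral_cst//= lebesgue_measure_itv/= lte_fin ltr1n -EFinB -EFinM lte_fin.
  by rewrite !mulr_gt0 ?expR_gt0//; lra.
apply: (@le_trans _ _ (\int[leb]_(x in `[1%R, 2%R]) (gamma_integrand alpha x)%:E)%E).
  apply: ge0_le_integral => //.
  - exact: mg.
  move=> x; rewrite /= in_itv/= => /andP[x1 x2]; rewrite lee_fin /gamma_integrand.
  have x0 : 0 < x by exact: lt_le_trans x1.
  apply: ler_pM; rewrite ?expR_ge0//; last by rewrite ler_expR lerN2.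
  apply: (@le_trans _ _ (x `^ (- 1))).
    by rewrite powRN powRr1 ?(ltW x0)//  lef_pV2 ?posrE.
  by rewrite ler_powR// lerBrDl subrr ltW.
apply: ge0_subset_integral => //.
- exact: mg.
- by move=> x _; rewrite lee_fin gamma_integrand_ge0.
- by apply: subset_itv; rewrite bnd_simp.
Qed.

Lemma Gamma_funE (alpha : R) : 0 < alpha ->
  ((Gamma_fun alpha)%:E = \int[leb]_(x in `]0%R, +oo[) (gamma_integrand alpha x)%:E)%E.
Proof.
move=> al0; rewrite /Gamma_fun /Rintegral fineK// ge0_fin_numE ?integral_gamma_lty//.
by apply: integral_ge0 => x _; rewrite lee_fin gamma_integrand_ge0.
Qed.

Lemma Gamma_fun_gt0 (alpha : R) : 0 < alpha -> 0 < Gamma_fun alpha.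
Proof. by move=> al0; rewrite -lte_fin Gamma_funE// integral_gamma_gt0. Qed.

Lemma ge0_integral_scaling (k : R) (f : R -> \bar R) : 0 < k ->
  measurable_fun setT f -> (forall y, 0 <= f y)%E ->
  (\int[leb]_y f y = k%:E * \int[leb]_y f (k * y)%R)%E.
Proof.
move=> k0 mf f0; pose E := measurableTypeR R.
have mk : measurable_fun setT ((fun y => k * y) : E -> E) by exact: mulrl_measurable.
have mfk : measurable_fun setT (fun y : R => f (k * y)).
  by apply: measurableT_comp => //; exact: mulrl_measurable.
pose pf : {measure set E -> \bar R} := pushforward leb ((fun y => k * y) : E -> E).
pose mu : {measure set E -> \bar R} := mscale (NngNum (ltW k0)) (pf mk).
transitivity (\int[mu]_y f y)%E.
  apply: eq_measure_integral => A mA _.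
  apply: lebesgue_measure_unique => //= _ [[a b]] _ <-.
  rewrite /mscale /= /pushforward (_ : _ @^-1` _ = `](a / k), (b / k)]%classic).
    rewrite !lebesgue_measure_itv/= !lte_fin ltr_pM2r ?invr_gt0//.
    case: ifP => _; last by rewrite mule0.
    by rewrite -!EFinB -EFinM; congr (_%:E); field; rewrite gt_eqF.
  by apply/seteqP; split => y /=; rewrite !in_itv/= ltr_pdivrMr// ler_pdivlMr// !(mulrC y).
rewrite ge0_integral_mscale//; congr (_ * _)%E.
by rewrite ge0_integral_pushforward.
Qed.

Lemma gamma_laplace (alpha c : R) : 0 < alpha -> 0 < c ->
  (\int[leb]_(x in `]0%R, +oo[) (x `^ (alpha - 1) * expR (- (c * x)))%:E =
   (c `^ (- alpha) * Gamma_fun alpha)%:E)%E.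
Proof.
move=> al0 c0.
pose f (y : R) : \bar R := if 0 < y then (gamma_integrand alpha y)%:E else 0%E.
have f0 y : (0 <= f y)%E.
  by rewrite /f; case: ifP => // _; rewrite lee_fin gamma_integrand_ge0.
have mf : measurable_fun setT f.
  apply: measurable_fun_ifT => //; first exact: measurable_fun_ltr.
  by apply/measurable_EFinP; exact: measurable_gamma_integrand.
have fE : (\int[leb]_y f y = (Gamma_fun alpha)%:E)%E.
  rewrite Gamma_funE// [RHS]integral_mkcond; apply: eq_integral => y _.
  rewrite patchE /f; have [y0|y0] := boolP (0 < y).
    by rewrite mem_set//= in_itv/= y0.
  by rewrite memNset//= in_itv/= (negbTE y0).
rewrite EFinM -fE (ge0_integral_scaling c0 mf f0) muleA -EFinM.
have -> : c `^ (- alpha) * c = c `^ (1 - alpha).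
  by rewrite (addrC 1) powRD ?(gt_eqF c0) ?implybT// powRr1// ltW.
rewrite -ge0_integralZl//; last 2 first.
- by apply: measurableT_comp => //; exact: mulrl_measurable.
- by rewrite lee_fin powR_ge0.
rewrite [LHS]integral_mkcond; apply: eq_integral => y _.
rewrite patchE /f pmulr_rgt0//; have [y0|y0] := boolP (0 < y); last first.
  by rewrite memNset/= ?in_itv/= ?(negbTE y0)// mule0.
rewrite mem_set/= ?in_itv/= ?y0// -EFinM /gamma_integrand powRM ?ltW//.
rewrite !mulrA -powRD ?(gt_eqF c0) ?implybT//.
have -> : 1 - alpha + (alpha - 1) = 0 by ring.
by rewrite powRr0 mul1r.
Qed.

Lemma measurable_gamma_pdf (alpha beta : R) : measurable_fun setT (gamma_pdf alpha beta).
Proof.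
apply: measurable_fun_ifT => //; first exact: measurable_fun_ltr.
apply: measurable_funM => //; apply: measurable_funM; first exact: measurable_powR.
by apply: measurableT_comp => //; apply: measurableT_comp => //; exact: measurable_funM.
Qed.

Section gamma_prob.
Variables alpha beta : R.
Hypotheses (alpha0 : 0 < alpha) (beta0 : 0 < beta).

Lemma gamma_pdf_ge0 x : 0 <= gamma_pdf alpha beta x.
Proof.
rewrite /gamma_pdf; case: ifP => // _.
by rewrite !(mulr_ge0, invr_ge0) ?powR_ge0 ?expR_ge0 ?ltW ?Gamma_fun_gt0.
Qed.

Lemma gamma_pdf_laplace (k : R) : 0 <= k ->
  (\int[leb]_x (expR (- (k * x)) * gamma_pdf alpha beta x)%:E =
   ((1 + k * beta) `^ (- alpha))%:E)%E.
Proof.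
move=> k0; have c0 : 0 < k + beta^-1 by rewrite ltr_wpDl// invr_gt0.
have G0 := Gamma_fun_gt0 alpha0.
pose C := (Gamma_fun alpha * beta `^ alpha)^-1.
have epoch_bound : 0 <= C by rewrite invr_ge0 mulr_ge0 ?powR_ge0// ltW.
transitivity (C%:E * \int[leb]_(x in `]0%R, +oo[)
    (x `^ (alpha - 1) * expR (- ((k + beta^-1) * x)))%:E)%E.
  rewrite -ge0_integralZl//; last 2 first.
  - apply: measurable_funTS; apply/measurable_EFinP.
    apply: measurable_funM; first exact: measurable_powR.
    by apply: measurableT_comp => //; exact: measurableT_comp.
  - by move=> x _; rewrite lee_fin mulr_ge0 ?powR_ge0 ?expR_ge0.
  rewrite [RHS]integral_mkcond; apply: eq_integral => y _.
  rewrite patchE /gamma_pdf; have [y0|y0] := boolP (0 < y); last first.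
    by rewrite memNset/= ?in_itv/= ?(negbTE y0)// mulr0.
  rewrite mem_set/= ?in_itv/= ?y0// -EFinM; congr (_%:E).
  by rewrite mulrDl opprD expRD (mulrC beta^-1) -/C; ring.
rewrite gamma_laplace// -EFinM; congr (_%:E); rewrite /C.
have -> : 1 + k * beta = (k + beta^-1) * beta by rewrite mulrDl mulVf ?gt_eqF// addrC.
rewrite powRM ?ltW// [in RHS](powRN beta) invfM; field.
by rewrite !gt_eqF// powR_gt0.
Qed.

(** The same function as [gamma_law], on the copy of the reals that carries the
    Lebesgue measure. *)
Definition gamma_measure (A : set (measurableTypeR R)) : \bar R := gamma_law alpha beta A.

Let gamma_law0 : gamma_measure set0 = 0%E.
Proof. by rewrite /gamma_measure /gamma_law integral_set0. Qed.

Let gamma_law_ge0 A : (0 <= gamma_measure A)%E.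
Proof. by apply: integral_ge0 => x _; rewrite lee_fin gamma_pdf_ge0. Qed.

Let gamma_law_sigma_additive : semi_sigma_additive gamma_measure.
Proof.
move=> /= F mF tF mUF; rewrite /gamma_measure /gamma_law; apply: cvg_toP.
  apply: ereal_nondecreasing_is_cvgn => m n mn.
  by apply: lee_sum_nneg_natr => // k _ _; exact: gamma_law_ge0.
rewrite ge0_integral_bigcup//=.
- by apply/measurable_funTS/measurable_EFinP; exact: measurable_gamma_pdf.
- by move=> x _; rewrite lee_fin gamma_pdf_ge0.
Qed.

HB.instance Definition _ := isMeasure.Build _ (measurableTypeR R) R
  gamma_measure gamma_law0 gamma_law_ge0 gamma_law_sigma_additive.

Let gamma_law_setT : gamma_measure setT = 1%E.
Proof.
have := gamma_pdf_laplace (lexx 0); rewrite mul0r addr0 powR1 => <-.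
by apply: eq_integral => x _; rewrite mul0r oppr0 expR0 mul1r.
Qed.

HB.instance Definition _ :=
  @Measure_isProbability.Build _ (measurableTypeR R) R gamma_measure gamma_law_setT.

Definition gamma_prob : probability (measurableTypeR R) R := gamma_measure.

Lemma gamma_prob_laplace (k : R) : 0 <= k ->
  (\int[gamma_prob]_x (expR (- (k * x)))%:E = ((1 + k * beta) `^ (- alpha))%:E)%E.
Proof.
move=> k0; rewrite -gamma_pdf_laplace//.
have mpdf := measurable_gamma_pdf alpha beta.
rewrite (@ge0_integral_density _ (measurableTypeR R) R leb gamma_prob
  (gamma_pdf alpha beta))//.
- by move=> x; exact: gamma_pdf_ge0.
- apply/measurable_EFinP; apply: measurableT_comp => //; exact: measurableT_comp.
Qed.

Lemma gamma_prob_ge0 : {ae gamma_prob, forall x : R, 0 <= x}.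
Proof.
exists `]-oo, 0[%classic; split => //.
- apply: integral0_eq => x; rewrite /= in_itv/= => x0.
  by rewrite /gamma_pdf ltNge (ltW x0).
- by move=> x /= /negP; rewrite in_itv/= -ltNge.
Qed.

End gamma_prob.
End gamma_function.

(** * From Laplace moments to distribution functions *)
Section bernstein.
Context {R : realType}.

(** The Bernstein polynomial of degree N with coefficients phi 0, ..., phi N, defined
    by de Casteljau recursion: at y, the expectation of phi at a binomial variable
    of size N and success probability y, conditioned on its first trial. *)
Fixpoint bernstein (N : nat) (phi : nat -> R) : {poly R} :=
  if N is N'.+1 then 'X * bernstein N' (phi \o S) + (1 - 'X) * bernstein N' phi
  else (phi 0%N)%:P.

Lemma bernsteinS N phi y : (bernstein N.+1 phi).[y] =
  y * (bernstein N (phi \o S)).[y] + (1 - y) * (bernstein N phi).[y].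
Proof. by rewrite /= !hornerE. Qed.

Lemma bernstein_affine N A B phi y :
  (bernstein N (fun j => A + B * phi j)).[y] = A + B * (bernstein N phi).[y].
Proof.
elim: N phi => [|N IH] phi; first by rewrite /= !hornerE.
by rewrite !bernsteinS (IH (phi \o S)) IH; ring.
Qed.

Lemma le_bernstein N phi psi y : 0 <= y <= 1 -> (forall j, phi j <= psi j) ->
  (bernstein N phi).[y] <= (bernstein N psi).[y].
Proof.
move=> /andP[y0 y1]; elim: N phi psi => [|N IH] phi psi le; first by rewrite /= !hornerE.
rewrite !bernsteinS lerD// ler_wpM2l ?subr_ge0 ?IH//.
by move=> j; exact: le.
Qed.

(** The second moment about c of a binomial variable: variance plus squared bias. *)
Lemma bernstein_sqr N c y :
  (bernstein N (fun j => (j%:R - c) ^+ 2)).[y] = N%:R * y * (1 - y) + (N%:R * y - c) ^+ 2.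
Proof.
elim: N c => [|N IH] c; first by rewrite /= !hornerE; ring.
rewrite bernsteinS IH.
rewrite (_ : _ \o S = fun j => (j%:R - (c - 1)) ^+ 2).
  by rewrite IH -natr1; ring.
by apply/funext => j /=; rewrite -natr1; congr (_ ^+ 2); ring.
Qed.

(** With v = j / N - y, the inequality |v| <= eta / 2 + v^2 / (2 eta) bounds the
    oscillation of f by a quadratic polynomial in j, of which [bernstein_sqr] gives
    the mean; eta is proportional to e and N larger than eta ^ (- 2). *)
Lemma lipschitz_poly_approx (f : R -> R) (K e : R) : 0 < e ->
  (forall u v, `|f u - f v| <= K * `|u - v|) ->
  exists p : {poly R}, forall y, 0 <= y <= 1 -> `|p.[y] - f y| <= e.
Proof.
move=> e0 fK.
have K0 : 0 <= K by have := le_trans (normr_ge0 _) (fK 1 0); rewrite subr0 normr1 mulr1.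
pose K' := K + 1; have K'0 : 0 < K' by rewrite ltr_wpDl.
have [eta [eta0 eE]] : exists eta, 0 < eta /\ e = K' * eta.
  by exists (e / K'); rewrite divr_gt0// mulrC divfK// gt_eqF.
have [N [N0 Neta]] : exists N : nat, 0 < N%:R :> R /\ eta ^- 2 < N%:R.
  by exists (Num.truncn (eta ^- 2)).+1; rewrite ltr0n truncnS_gt.
pose A := K * eta / 2; pose B := K / (2 * eta * N%:R ^+ 2).
have B0 : 0 <= B by rewrite divr_ge0// !mulr_ge0// ltW.
exists (bernstein N (fun j => f (j%:R / N%:R))) => y y01.
have /andP[y0 y1] := y01.
have dist j : `|f (j%:R / N%:R) - f y| <= A + B * (j%:R - N%:R * y) ^+ 2.
  apply: (le_trans (fK _ _)).
  pose v := j%:R / N%:R - y.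
  have -> : A + B * (j%:R - N%:R * y) ^+ 2 = K * (eta / 2 + v ^+ 2 / (2 * eta)).
    by rewrite /A /B /v; field; rewrite !gt_eqF.
  rewrite -/v ler_wpM2l// -real_normK ?num_real//.
  rewrite -subr_ge0.
  have -> : eta / 2 + `|v| ^+ 2 / (2 * eta) - `|v| = (eta - `|v|) ^+ 2 / (2 * eta).
    by field; rewrite gt_eqF.
  by rewrite divr_ge0 ?sqr_ge0// mulr_ge0// ltW.
have small : A + B * (bernstein N (fun j => (j%:R - N%:R * y) ^+ 2)).[y] <= e.
  rewrite bernstein_sqr subrr expr0n/= addr0.
  apply: (@le_trans _ _ (A + B * N%:R)).
    rewrite lerD2l ler_wpM2l// -mulrA ler_piMr ?ltW//.
    have : 0 <= (1 - y) ^+ 2 by exact: sqr_ge0.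
    by nra.
  have -> : A + B * N%:R = K / 2 * (eta + (eta * N%:R)^-1).
    by rewrite /A /B; field; rewrite !gt_eqF.
  have : (eta * N%:R)^-1 <= eta.
    rewrite invf_ple ?posrE ?mulr_gt0// -ler_pdivrMl//.
    by rewrite -invfM -expr2 ltW.
  rewrite eE /K' => ?; have : K / 2 * (eta + (eta * N%:R)^-1) <= K / 2 * (eta + eta).
    by rewrite ler_wpM2l ?divr_ge0// lerD2l.
  by nra.
rewrite ler_distl; apply/andP; split.
  apply: (@le_trans _ _ (f y - (A + B * (bernstein N (fun j => (j%:R - N%:R * y) ^+ 2)).[y]))).
    by rewrite lerD2l lerN2.
  rewrite opprD addrA -[- (B * _)]mulNr -bernstein_affine; apply: le_bernstein => // j.
  have := dist j; rewrite ler_distl => /andP[+ _]; lra.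
apply: (@le_trans _ _ (f y + (A + B * (bernstein N (fun j => (j%:R - N%:R * y) ^+ 2)).[y])));
  last by rewrite lerD2l.
rewrite addrA -bernstein_affine; apply: le_bernstein => // j.
have := dist j; rewrite ler_distl => /andP[_ +]; lra.
Qed.

End bernstein.

Section ramp.
Context {R : realType}.

Definition ramp (l u y : R) : R := Num.min 1 (Num.max 0 ((y - l) / (u - l))).

Lemma ramp_ge0 l u y : 0 <= ramp l u y.
Proof. by rewrite /ramp le_min ler01 le_max lexx. Qed.

Lemma ramp_le1 l u y : ramp l u y <= 1.
Proof. by rewrite /ramp ge_min lexx. Qed.

Lemma ramp_eq1 l u y : l < u -> u <= y -> ramp l u y = 1.
Proof.
move=> lu uy; rewrite /ramp; apply/min_idPl; rewrite le_max; apply/orP; right.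
by rewrite ler_pdivlMr ?subr_gt0// mul1r lerD2r.
Qed.

Lemma ramp_eq0 l u y : l < u -> y <= l -> ramp l u y = 0.
Proof.
move=> lu yl; rewrite /ramp (max_idPl _) ?(min_idPr _)//.
by rewrite ler_pdivrMr ?subr_gt0// mul0r subr_le0.
Qed.

Lemma ramp_lipschitz l u : l < u ->
  forall y z, `|ramp l u y - ramp l u z| <= (u - l)^-1 * `|y - z|.
Proof.
move=> lu y z; have ul : 0 < (u - l)^-1 by rewrite invr_gt0 subr_gt0.
have -> : (u - l)^-1 * `|y - z| = `|(y - l) / (u - l) - (z - l) / (u - l)|.
  by rewrite -mulrBl opprB addrA subrK normrM (gtr0_norm ul) mulrC.
rewrite /ramp; move: (_ / _) (_ / _) => w v.
case: (leP 0 v) => v0; case: (leP 0 w) => w0; rewrite ?(min_r ler01).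
- have vw1 := ler_norm (v - w); have vw2 := ler_norm (w - v).
  rewrite (distrC w) in vw2.
  by case: (leP 1 v) => v1; case: (leP 1 w) => w1; rewrite ler_norml; apply/andP; split; lra.
- case: (leP 1 v) => v1; rewrite ler_norml; case: (ger0P (v - w)) => vw; apply/andP; split; lra.
- case: (leP 1 w) => w1; rewrite ler_norml; case: (ger0P (v - w)) => vw; apply/andP; split; lra.
- by rewrite subrr normr0.
Qed.

End ramp.

Section moments.
Context d (S : measurableType d) (R : realType) (mu : probability S R).
Variable V : S -> R.
Hypotheses (mV : measurable_fun setT V) (V0 : {ae mu, forall x, 0 <= V x}).

Definition laplace_moment (k : nat) : R := fine (\int[mu]_x (expR (- (k%:R * V x)))%:E)%E.

Let mexp k : measurable_fun setT (fun x => expR (- (k%:R * V x))).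
Proof.
apply: measurableT_comp => //; apply: measurableT_comp => //.
exact: measurable_funM.
Qed.

Lemma integrable_expR_natM k : mu.-integrable setT (fun x => (expR (- (k%:R * V x)))%:E).
Proof.
apply/integrableP; split; first exact/measurable_EFinP.
apply: (@le_lt_trans _ _ (\int[mu]_x 1)%E); last first.
  by rewrite integral_cst//= mul1e probability_setT ltry.
apply: ae_ge0_le_integral => //.
- exact/measurableT_comp/measurable_EFinP.
- move: V0; apply: filterS => x Vx _.
  by rewrite lee_fin ger0_norm ?expR_ge0// -[leRHS]expR0 ler_expR oppr_le0 mulr_ge0.
Qed.

Lemma integral_poly_expR (p : {poly R}) :
  mu.-integrable setT (fun x => (p.[expR (- V x)])%:E) /\
  (\int[mu]_x (p.[expR (- V x)])%:E = (\sum_(i < size p) p`_i * laplace_moment i)%:E)%E.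
Proof.
have pE x : (p.[expR (- V x)])%:E =
    (\sum_(i < size p) (p`_i)%:E * (expR (- (i%:R * V x)))%:E)%E.
  rewrite horner_coef -sumEFin; apply: eq_bigr => i _; rewrite EFinM; congr (_ * _%:E)%E.
  by rewrite -expRM_natl mulrN.
have ip i : mu.-integrable setT (fun x => (p`_i)%:E * (expR (- (i%:R * V x)))%:E)%E.
  by apply: integrableZl => //; exact: integrable_expR_natM.
split.
  apply: (eq_integrable measurableT
    (fun x => \sum_(i < size p) (p`_i)%:E * (expR (- (i%:R * V x)))%:E)%E).
    by move=> x _; rewrite pE.
  by apply: integrable_sum => // i _.
under eq_integral do rewrite pE.
rewrite integral_sum// -sumEFin; apply: eq_bigr => i _.
rewrite integralZl//; last exact: integrable_expR_natM.
rewrite EFinM fineK//; apply: integrable_fin_num => //; exact: integrable_expR_natM.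
Qed.

End moments.

Lemma ae_le_integral d (S : measurableType d) (R : realType) (mu : {measure set S -> \bar R})
    (f g : S -> \bar R) :
  mu.-integrable setT f -> mu.-integrable setT g -> {ae mu, forall x, (f x <= g x)%E} ->
  (\int[mu]_x f x <= \int[mu]_x g x)%E.
Proof.
move=> intf intg [N [mN muN fg]].
have mTN : measurable (setT `\` N) by exact: measurableD.
rewrite (negligible_integral mN _ intf muN)// (negligible_integral mN _ intg muN)//.
apply: le_integral => //.
- exact: integrableS intf.
- exact: integrableS intg.
- by move=> x; rewrite inE => -[_ /= Nx]; apply: contrapT => nfg; apply: Nx; exact: fg.
Qed.

Section sandwich.
Context {R : realType}.

(** The polynomial approximates a ramp that increases from 0 at exp (- x') to 1 at
    exp (- x), evaluated at exp (- V). It depends on x, x' and e only, not on the law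
    of V. *)
Lemma laplace_moment_sandwich (x x' e : R) : x < x' -> 0 < e ->
  exists p : {poly R}, forall d (S : measurableType d) (mu : probability S R) (V : S -> R),
    measurable_fun setT V -> {ae mu, forall s, 0 <= V s} ->
    let L := \sum_(i < size p) p`_i * laplace_moment mu V i in
    fine (mu [set s | V s <= x]) <= L + e /\ L <= fine (mu [set s | V s <= x']) + e.
Proof.
move=> xx' e0.
have lu : expR (- x') < expR (- x) by rewrite ltr_expR ltrN2.
have [p pf] := lipschitz_poly_approx e0 (ramp_lipschitz lu).
exists p => d S mu V mV V0 L.
have [pint pE] := integral_poly_expR mV V0 p.
have mset z : measurable [set s | V s <= z].
  rewrite (_ : [set s | V s <= z] = setT `&` V @^-1` `]-oo, z]); first exact: mV.
  by apply/seteqP; split => s /=; rewrite in_itv/=; [move=> ?; split|case].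
have iind z : mu.-integrable setT (fun s => (\1_[set s | V s <= z] s)%:E).
  exact: integrable_indic.
have ie : mu.-integrable setT (fun=> e%:E) by exact: finite_measure_integrable_cst.
have eE : (\int[mu]_s e%:E = e%:E)%E by rewrite integral_cst//= probability_setT mule1.
have indE z : (\int[mu]_s (\1_[set s | V s <= z] s)%:E = (fine (mu [set s | V s <= z]))%:E)%E.
  by rewrite integral_indic// setIT fineK// fin_num_measure.
have bnd : {ae mu, forall s,
    (\1_[set s | V s <= x] s <= p.[expR (- V s)] + e) /\
    (p.[expR (- V s)] <= \1_[set s | V s <= x'] s + e)}.
  move: V0; apply: filterS => s Vs.
  have y01 : 0 <= expR (- V s) <= 1.
    by rewrite expR_ge0 -[leRHS]expR0 ler_expR oppr_le0.
  have := pf _ y01; rewrite ler_distl => /andP[pl pu].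
  have r0 := ramp_ge0 (expR (- x')) (expR (- x)) (expR (- V s)).
  have r1 := ramp_le1 (expR (- x')) (expR (- x)) (expR (- V s)).
  rewrite !indicE; split.
    have [/set_mem /= Vx|_] := boolP (s \in _); last by rewrite /=; lra.
    by move: pl; rewrite ramp_eq1 ?ler_expR ?lerN2//=; lra.
  have [_|/negP Vx] := boolP (s \in _); first by rewrite /=; lra.
  have Vx' : x' <= V s by rewrite leNgt; apply/negP => /ltW h; apply: Vx; rewrite inE.
  by move: pu; rewrite ramp_eq0 ?ler_expR ?lerN2//=; lra.
have addE (f : S -> \bar R) : mu.-integrable setT f ->
    (\int[mu]_s (f s + e%:E) = \int[mu]_s f s + e%:E)%E.
  by move=> intf; rewrite integralD// eE.
split.
  rewrite -lee_fin EFinD -indE -pE -(addE _ pint).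
  apply: ae_le_integral; [exact: iind|exact: integrableD|].
  by move: bnd; apply: filterS => s [b1 _]; rewrite -EFinD lee_fin.
rewrite -lee_fin EFinD -indE -pE -(addE _ (iind x')).
apply: ae_le_integral; [exact: pint|apply: integrableD => //; exact: iind|].
by move: bnd; apply: filterS => s [_ b2]; rewrite -EFinD lee_fin.
Qed.

(** For a fixed polynomial the bounds of [laplace_moment_sandwich] involve finitely
    many moments, which converge; by continuity the limiting distribution function
    at x + del and x - del is close to its value at x. *)
Lemma cdf_cvg_of_laplace d (T : measurableType d) (P : probability T R)
    (Z : R -> {RV P >-> R}) (gam : probability (measurableTypeR R) R) :
  (\forall t \near +oo, {ae P, forall x, 0 <= Z t x}) ->
  {ae gam, forall x : R, 0 <= x} ->
  (forall k, laplace_moment P (Z t) k @[t --> +oo] --> laplace_moment gam id k) ->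
  cvg_in_distribution Z (gam : set R -> \bar R).
Proof.
move=> Z0 g0 mom x cx.
pose G (y : R) := fine (gam `]-oo, y]%classic).
have GE y : gam `]-oo, y]%classic = (G y)%:E by rewrite /G fineK// fin_num_measure.
have cG : {for x, continuous G}.
  by move: cx; rewrite /prop_for /continuous_at GE => /fine_cvgP[].
have FE t : cdf (Z t) x = (fine (P [set s | Z t s <= x]))%:E.
  have -> : [set s | Z t s <= x] = Z t @^-1` `]-oo, x].
    by apply/seteqP; split => s /=; rewrite in_itv.
  by rewrite fineK// fin_num_measure//; exact: measurable_funPTI.
have gset y : gam [set s : R | s <= y] = gam `]-oo, y]%classic.
  by congr (gam _); apply/seteqP; split => s /=; rewrite in_itv.
rewrite GE; under eq_fun do rewrite FE.
apply: cvg_EFin; first exact: nearW.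
apply/cvgrPdist_le => e e0.
have e4 : 0 < e / 4 by rewrite divr_gt0.
have [del del0 Gdel] : exists2 del, 0 < del & forall y, `|x - y| <= del -> `|G x - G y| <= e / 4.
  have /cvgrPdist_le /(_ _ e4) /nbhs_ballP[r /= r0 rG] := cG.
  exists (r / 2); first by rewrite divr_gt0.
  by move=> y xy; apply: rG; rewrite /ball /= (le_lt_trans xy)// ltr_pdivrMr// ltr_pMr// ltr1n.
have xdel : x < x + del by rewrite ltrDl.
have delx : x - del < x by rewrite gtrBl.
have [pu pubound] := laplace_moment_sandwich xdel e4.
have [pl plbound] := laplace_moment_sandwich delx e4.
have cvL (p : {poly R}) : \sum_(i < size p) p`_i * laplace_moment P (Z t) i @[t --> +oo] -->
    \sum_(i < size p) p`_i * laplace_moment gam id i.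
  apply: cvg_big => [|i _]; first exact: add_continuous.
  by apply: cvgM; [exact: cvg_cst|exact: mom].
have mid : measurable_fun setT (id : measurableTypeR R -> R) by [].
have [_ gu] := pubound _ _ gam id mid g0.
have [gl _] := plbound _ _ gam id mid g0.
have /cvgrPdist_le /(_ _ e4) cu := cvL pu.
have /cvgrPdist_le /(_ _ e4) cl := cvL pl.
have Gu : `|G x - G (x + del)| <= e / 4.
  by apply: Gdel; rewrite opprD addNKr normrN gtr0_norm.
have Gl : `|G x - G (x - del)| <= e / 4.
  by apply: Gdel; rewrite opprB addrC subrK gtr0_norm.
near=> t.
have Zt : {ae P, forall x, 0 <= Z t x} by near: t.
have mZ : measurable_fun setT (Z t) by exact: measurable_funP.
have [Fu _] := pubound _ _ P (Z t) mZ Zt.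
have [_ Fl] := plbound _ _ P (Z t) mZ Zt.
have cut : `|\sum_(i < size pu) pu`_i * laplace_moment gam id i -
    \sum_(i < size pu) pu`_i * laplace_moment P (Z t) i| <= e / 4 by near: t.
have clt : `|\sum_(i < size pl) pl`_i * laplace_moment gam id i -
    \sum_(i < size pl) pl`_i * laplace_moment P (Z t) i| <= e / 4 by near: t.
move: Gu Gl cut clt gu gl Fu Fl; rewrite !gset -!/(G _) !ler_norml.
move: (\sum_(i < _) _) (\sum_(i < _) _) (\sum_(i < _) _) (\sum_(i < _) _) => A1 A2 A3 A4.
rewrite /=; move=> /andP[? ?] /andP[? ?] /andP[? ?] /andP[? ?] ? ? ? ?.
by apply/andP; split; lra.
Unshelve. all: by end_near. Qed.

End sandwich.

(** * Convergence to the gamma law *)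
(** Drawing white balls only, tenability forbids a remainder strictly between 0
    and a. *)
Lemma tenable_dvdn (a w0 b0 : nat) : (0 < a)%N ->
  tenable (constant_differentials_mx a) w0 b0 -> (a %| w0)%N.
Proof.
move=> a0 ten.
suff key n w b : (w <= n)%N -> reachable (constant_differentials_mx a) w0 b0 w b -> (a %| w)%N.
  by apply: (key w0 w0 b0); [exact: leqnn|exact: reachable_init].
elim: n w b => [|n IH] w b wn wb; first by move: wn; rewrite leqn0 => /eqP ->.
have [->//|w_gt0] := posnP w.
have [_ /(_ w_gt0) [aw ab] _] := ten _ _ wb.
rewrite !mxE /= in aw ab.
have {}aw : (a <= w)%N by lia.
have {}ab : (a <= b)%N by lia.
rewrite -(dvdn_subl aw)//.
apply: (IH (w - a)%N (b - a)%N); first by lia.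
by apply: (reachable_white wb); rewrite // !mxE /=; lia.
Qed.

Lemma cvg_inv_pinfty {R : realType} : t^-1 @[t --> +oo] --> (0 : R).
Proof. by apply/gtr0_cvgV0; [exact: nbhs_pinfty_gt|exact: cvg_id]. Qed.

(** Squeezed between c / (1 + c / t) and c, by exp y >= 1 + y for both signs of y. *)
Lemma cvg_mul_one_subr_expR {R : realType} (c : R) : 0 <= c ->
  t * (1 - expR (- (c / t))) @[t --> +oo] --> c.
Proof.
move=> c0.
apply: (@squeeze_cvgr _ _ _ _ (fun t : R => c / (1 + c / t)) (fun=> c)).
- near=> t; have t0 : 0 < t by near: t; exact: nbhs_pinfty_gt.
  have ct0 : 0 <= c / t by rewrite divr_ge0// ltW.
  have u0 : 0 < 1 + c / t by rewrite ltr_wpDr.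
  apply/andP; split.
    have : expR (- (c / t)) <= (1 + c / t)^-1.
      by rewrite expRN lef_pV2 ?posrE ?expR_gt0 ?expR_ge1Dx.
    have -> : c / (1 + c / t) = t * (1 - (1 + c / t)^-1).
      by field; rewrite gt_eqF ?gt_eqF ?ltr_wpDr//=.
    by move=> h; apply: ler_wpM2l; [exact: ltW|rewrite lerD2l lerN2].
  rewrite -ler_pdivlMl// lerBlDr -lerBlDl.
  by rewrite mulrC (le_trans _ (expR_ge1Dx _)).
- rewrite -[X in _ --> X]divr1; apply: cvgM; first exact: cvg_cst.
  apply: cvgV => //; rewrite -[X in _ --> X]addr0; apply: cvgD; first exact: cvg_cst.
  rewrite -[X in _ --> X](mulr0 c); apply: cvgM; first exact: cvg_cst.
  exact: cvg_inv_pinfty.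
- exact: cvg_cst.
Unshelve. all: by end_near. Qed.

Lemma laplace_payoff_cvg {R : realType} (a D w0 k : nat) : (0 < a)%N -> (0 < k)%N ->
  laplace_payoff a D t (1 - expR (- (a%:R * (k%:R / t)))) 0 0 w0 @[t --> +oo] -->
  (1 + k%:R * a%:R ^+ 2 : R) `^ (- (D%:R / a%:R)).
Proof.
move=> a0 k0.
pose q (t : R) : R := 1 - expR (- (a%:R * (k%:R / t))).
pose m : R := 1 + k%:R * a%:R ^+ 2.
have m0 : 0 < m by rewrite ltr_wpDr// mulr_ge0// exprn_ge0.
have tq : t * q t @[t --> +oo] --> (a%:R * k%:R : R).
  rewrite /q; under eq_fun do rewrite mulrA.
  by apply: cvg_mul_one_subr_expR; rewrite mulr_ge0.
have cq : q t @[t --> +oo] --> (0 : R).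
  rewrite -[X in _ --> X](mulr0 (a%:R * k%:R)).
  have : (t * q t) * t^-1 @[t --> +oo] --> (a%:R * k%:R * 0 : R).
    by apply: cvgM; [exact: tq|exact: cvg_inv_pinfty].
  apply: cvg_trans; apply: near_eq_cvg; near=> t.
  by rewrite mulrAC mulfV ?mul1r// gt_eqF//; near: t; exact: nbhs_pinfty_gt.
have cu : 1 + a%:R * q t * (t - 0) @[t --> +oo] --> m.
  rewrite /m (_ : k%:R * a%:R ^+ 2 = a%:R * (a%:R * k%:R)); last by ring.
  apply: cvgD; first exact: cvg_cst.
  under eq_fun do rewrite subr0 -mulrA (mulrC (q _)).
  by apply: cvgM; [exact: cvg_cst|exact: tq].
have -> : m `^ (- (D%:R / a%:R)) = expR (w0%:R / a%:R * ln m - (w0 + D)%:R / a%:R * ln m).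
  rewrite /powR gt_eqF//; congr expR; rewrite natrD; field.
  by rewrite pnatr_eq0 -lt0n.
apply: continuous_cvg; first exact: continuous_expR.
apply: cvgB; apply: cvgM; try exact: cvg_cst.
  apply: continuous_cvg; first exact: continuous_ln.
  by rewrite -[X in _ --> X]subr0; apply: cvgB.
by apply: continuous_cvg; [exact: continuous_ln|].
Unshelve. all: by end_near. Qed.

Lemma laplace_moment0 d (S : measurableType d) (R : realType)
    (mu : probability S R) (V : S -> R) :
  laplace_moment mu V 0 = 1.
Proof.
rewrite /laplace_moment (eq_integral (cst 1%E)).
  by rewrite integral_cst//= mul1e probability_setT.
by move=> x _; rewrite mul0r oppr0 expR0.
Qed.

Theorem theorem1 (d : measure_display) (T : measurableType d) (R : realType)
    (P : probability T R) (a : nat) (ha : (1 <= a)%N) (w0 b0 : nat)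
    (W B : R -> {RV P >-> R})
    (hproc : polya_process (constant_differentials_mx a) w0 b0 W B)
    (hten : tenable (constant_differentials_mx a) w0 b0)
    (Delta : int) (hDelta : Delta = differential_index w0 b0)
    (hDelta1 : 1 <= Delta) :
  cvg_in_distribution (fun t : R => t^-1 \o* W t : {RV P >-> R})
    (gamma_law (Delta%:~R / a%:R) (a%:R ^+ 2)).
Proof.
have aw0 := tenable_dvdn ha hten.
have [D D0 DE] : exists2 D : nat, (0 < D)%N & Delta = D%:Z.
  by exists `|Delta|%N; lia.
have b0E : b0 = (w0 + D)%N by move: hDelta; rewrite /differential_index DE; lia.
rewrite DE -pmulrn.
have aR : 0 < a%:R :> R by rewrite ltr0n.
have alpha0 : 0 < (D%:R / a%:R : R) by rewrite divr_gt0// ltr0n.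
have beta0 : 0 < (a%:R ^+ 2 : R) by rewrite exprn_gt0.
have [X expX WE] := hproc.
apply: (cdf_cvg_of_laplace (gam := gamma_prob alpha0 beta0)).
- near=> t; have t0 : 0 < t by near: t; exact: nbhs_pinfty_gt.
  have := ae_ge0_process ha D0 b0E aw0 expX (ltW t0) ltr01 WE.
  by apply: filterS => x Wx; rewrite /= mulr_ge0// invr_ge0 ltW.
- exact: gamma_prob_ge0.
move=> k; have [->|k0] := posnP k.
  rewrite laplace_moment0; under eq_fun do rewrite laplace_moment0.
  exact: cvg_cst.
have -> : laplace_moment (gamma_prob alpha0 beta0) id k =
    (1 + k%:R * a%:R ^+ 2) `^ (- (D%:R / a%:R)).
  by rewrite /laplace_moment gamma_prob_laplace.
have := @laplace_payoff_cvg R a D w0 k ha k0; apply: cvg_trans.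
apply: near_eq_cvg; near=> t.
have t0 : 0 < t by near: t; exact: nbhs_pinfty_gt.
have kt0 : 0 < k%:R / t by rewrite divr_gt0// ltr0n.
have := laplace_process ha D0 b0E aw0 expX (ltW t0) kt0 WE.
rewrite /laplace_moment => LE.
rewrite (_ : (\int[P]_x _)%E = (\int[P]_x (expR (- (k%:R / t * W t x)))%:E)%E).
  by rewrite LE.
by apply: eq_integral => x _ /=; congr (expR (- _))%:E; ring.
Unshelve. all: by end_near. Qed.
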